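(* The core of the incidence comodule bialgebra of the Baez–Dolan construction on the terminal operad is the Calaque–Ebrahimi-Fard–Manchon comodule bialgebra of rooted trees. That is, taking cores of (operadic) trees carries the comultiplication of the incidence bialgebra of $\mathrm{Bar}_{\mathsf{S}}(\mathsf{P}^{*})$ to the Butcher–Connes–Kreimer comultiplication, and carries the comultiplication of the incidence bialgebra of $\mathrm{Bar}_{\mathsf{S}}(\mathsf{P}^{\odot})$ and its coaction to the extraction-contraction comultiplication and coaction of the Calaque–Ebrahimi-Fard–Manchon comodule bialgebra, where $\mathsf{P}$ is the terminal operad, $\mathsf{P}^{*}$ the free operad on it and $\mathsf{P}^{\odot}$ its reduced Baez–Dolan construction.
   Context: **Rooted trees and the Calaque–Ebrahimi-Fard–Manchon comodule bialgebra.** A (combinatorial) rooted tree is a finite connected and simply connected graph with a distinguished vertex (the root); it has no open-ended edges. Consider the free commutative $\mathbb{Q}$-algebra on the set of isomorphism classes of rooted trees (monomials = forests). (i) Butcher–Connes–Kreimer comultiplication: $\Delta(T)=\sum_cP_c\otimes R_c$, the sum over admissible cuts $c$ of $T$, i.e. partitions of the set of nodes into a subset that is empty or forms a subtree $R_c$ containing the root, and its complement, which forms the forest $P_c$. (ii) Extraction-contraction comultiplication: $\Delta(T)=\sum(\text{forest of the subtrees})\otimes(\text{the tree obtained by contracting each subtree to a single node})$, the sum over all partitions of the node set of $T$ into (nonempty, connected) subtrees; the same formula is used as the coaction of bialgebra (ii) on (i) (the empty forest coacting as $1\mapsto1\otimes1$). With these, (i) is a left comodule bialgebra over (ii): the Calaque–Ebrahimi-Fard–Manchon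 comodule bialgebra. **Operadic trees and core.** An operadic tree is a diagram of finite sets $A\xleftarrow{s}M\xrightarrow{p}N\xrightarrow{t}A$ ($A$ edges, $N$ nodes, $M$ nodes with a marked input edge), with $t$ injective, $s$ injective with singleton complement (the root edge), and such that the walk-to-the-root function $\sigma:A\to A$ (fixing the root, $e\mapsto t(p(e))$ for $e\in M$) takes every edge to the root in finitely many steps; leaves are edges not in the image of $t$. The trivial tree has one edge and no nodes. The core of an operadic tree is the combinatorial rooted tree on its nodes and inner edges, obtained by deleting the leaf edges and the root edge (and any decorations); the core of the trivial tree is the empty forest. Taking core extends multiplicatively to forests. **The operads.** $\mathsf{P}=\mathsf{S}$ is the terminal operad (Comm), i.e. the free-symmetric-monoidal-category monad on groupoids; $\mathsf{P}$-trees are operadic trees without decoration. The free operad $\mathsf{P}^{*}$ has one colour, operations the operadic trees, arity the set of leaves, composition grafting onto leaves. The Baez–Dolan construction $\mathsf{P}^{\circ}$ has as colours the corollas (trees with one node), as operations the operadic trees, arity of a tree its set of nodes (input colour: the node as a corolla; output colour: the corolla with the same leaves), composition being substitution of trees into nodes. $\mathsf{P}^{\odot}$ is $\mathsf{P}^{\circ}$ with the nullary operations (trivial trees) removed. **Incidence comodule bialgebra** (after homotopy cardinality, with $\mathsf{S}X$ the groupoid of finite families of objects of $X$). For an operad $\mathsf{R}$ the two-sided bar construction $X=\mathrm{Bar}_{\mathsf{S}}(\mathsf{R})$ is the simplicial groupoid with $X_n$ the groupoid of monomials of $n$-level trees of operations of $\mathsf{R}$ (faces: compose adjacent levels, delete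 top or bottom level). Its incidence bialgebra (pull-push along $X_1\xleftarrow{d_1}X_2\xrightarrow{(d_2,d_0)}X_1\times X_1$) is the free commutative algebra on isomorphism classes of operations, with $\Delta(r)=\sum_{r=b\circ(a_1,\dots,a_n)}a_1\cdots a_n\otimes b$ (sum over the homotopy fibre of $d_1$ over $r$). For $\mathsf{R}=\mathsf{P}^{*}$ this is the polynomial algebra on operadic trees, comultiplied by summing over cuts into a bottom tree (right factor) and the forest of trees grafted on all its leaves (left factor). For $\mathsf{R}=\mathsf{P}^{\odot}$ it is the polynomial algebra on nontrivial operadic trees, comultiplied by summing over all active injections $K\to T$ (equivalently, partitions of the nodes of $T$ into connected subtrees, called blobs): the left factor is the forest of the blobs with their adjacent edges, the right factor is the tree $K$ obtained by contracting each blob to a node. The coaction of the latter bialgebra on the former is given by the same formula on all operadic trees $T$ (for $T$ trivial: $T\mapsto1\otimes T$). This is the incidence comodule bialgebra of the Baez–Dolan construction on $\mathsf{P}$. A left comodule bialgebra over a commutative bialgebra $H$ is a left $H$-comodule with a bialgebra structure whose four structure maps are $H$-comodule maps (tensor products of comodules carrying the coaction that multiplies the two $H$-factors). *)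

(* Defs.v *)
From HB Require Import structures.
From mathcomp Require Import boolp classical_sets.
From mathcomp Require Import all_boot all_order all_algebra.
From mathcomp Require Import finmap monalg.

Set Implicit Arguments.
Unset Strict Implicit.
Unset Printing Implicit Defensive.

Import GRing.Theory.
Local Open Scope ring_scope.

Definition Sym (X : choiceType) : comAlgType rat := {malg rat[{cmonom X}]}.

Definition gen (X : choiceType) (x : X) : Sym X := << ucm x >>.

(* The algebra map out of [Sym X] with prescribed values on the generators. *)
Definition extend (X : choiceType) (A : comAlgType rat) (F : X -> A) :
    Sym X -> A :=
  mmap (in_alg A) (fun m : {cmonom X} => \prod_(x <- finsupp m) F x ^+ m x).

(* Sym X (x) Sym Y is the free commutative algebra on the disjoint union of X
   and Y, with x (x) 1 the generator [inl x] and 1 (x) y the generator [inr y]. *)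
Definition Sym2 (X Y : choiceType) : comAlgType rat := Sym (X + Y)%type.

Definition tensl (X Y : choiceType) : Sym X -> Sym2 X Y :=
  extend (fun x => gen (inl x : (X + Y)%type)).
Definition tensr (X Y : choiceType) : Sym Y -> Sym2 X Y :=
  extend (fun y => gen (inr y : (X + Y)%type)).

(* f (x) g, for the algebra maps f and g given by F and G on generators. *)
Definition extend2 (X Y X' Y' : choiceType) (F : X -> Sym X') (G : Y -> Sym Y') :
    Sym2 X Y -> Sym2 X' Y' :=
  extend (fun z => match z with
                   | inl x => tensl Y' (F x)
                   | inr y => tensr X' (G y)
                   end).

Record groupoid := Groupoid {
  ob :> Type;
  hom : ob -> ob -> Type;
  idh : forall x, hom x x;
  cmp : forall x y z, hom x y -> hom y z -> hom x z;
  cmpA : forall x y z t (f : hom x y) (g : hom y z) (h : hom z t),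
    cmp f (cmp g h) = cmp (cmp f g) h;
  cmp1l : forall x y (f : hom x y), cmp (idh x) f = f;
  cmp1r : forall x y (f : hom x y), cmp f (idh y) = f;
  cmpV : forall x y (f : hom x y),
    exists g : hom y x, cmp f g = idh x /\ cmp g f = idh y
}.

(* A groupoid with a (small) set of isomorphism classes. *)
Record classified := Classified {
  gpd :> groupoid;
  pi0 : choiceType;
  cls : gpd -> pi0;
  clsP : forall x y, cls x = cls y <-> inhabited (hom x y);
  cls_surj : forall c, exists x, cls x = c
}.

(* Cardinality of a finite type, without a [finType] structure. *)
Definition ncard (T : Type) : nat :=
  xget 0%N (fun n => exists f : 'I_n -> T, bijective f).

(* The homotopy sum of f over a groupoid with finitely many components and
   finite automorphism groups: each isomorphism class counts with weight
   1 / |Aut|; s lists one object of each class. *)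
Definition hsum (X : Type) (H : X -> X -> Type) (V : lmodType rat) (f : X -> V) :
    V :=
  xget 0 (fun v => exists n, exists s : 'I_n -> X,
    (forall x, exists! i, inhabited (H x (s i))) /\
    v = \sum_(i < n) (ncard (H (s i) (s i)))%:R^-1 *: f (s i)).

(* An isomorphism-invariant function f, viewed on the isomorphism classes, where
   cl sends an object to its class. *)
Definition on_classes (X C : Type) (cl : X -> C) (V : zmodType) (f : X -> V)
    (c : C) : V :=
  xget 0 (fun v => exists x, cl x = c /\ v = f x).

(* The data in low simplicial degree of an operad [upp] acting from the right
   on a collection of operations [low] with inputs coloured by objects of [col]:
   operations b of [low] have inputs [arity b], and if the output colours of
   the operations a_i are identified with the input colours of b, there is a
   composite b o (a_i).  An operad is the case low = upp.  Only the data
   entering X_1 <- X_2 -> X_1 x X_1 are recorded. *)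
Record opaction := OpAction {
  low : classified;
  upp : classified;
  col : groupoid;
  arity : low -> finType;
  arity_map : forall b b', hom b b' -> arity b -> arity b';
  incol : forall b, arity b -> col;
  incol_map : forall b b' (u : hom b b') (i : arity b),
    hom (incol i) (incol (arity_map u i));
  outcol : upp -> col;
  outcol_map : forall a a', hom a a' -> hom (outcol a) (outcol a');
  act : forall b (a : arity b -> upp),
    (forall i, hom (outcol (a i)) (incol i)) -> low;
  act_map : forall b (a : arity b -> upp) k b' (a' : arity b' -> upp) k'
    (u : hom b b') (v : forall i, hom (a i) (a' (arity_map u i))),
    (forall i, cmp (outcol_map (v i)) (k' (arity_map u i)) =
               cmp (k i) (incol_map u i)) ->
    hom (act k) (act k')
}.

Section Incidence.
Variable R : opaction.

(* The groupoid of (connected) 2-level trees: X_2 consists of the finite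
   families of these, and its face d_1 is [compose] on members. *)
Record twolevel := TwoLevel {
  bot : low R;
  top : arity bot -> upp R;
  glue : forall i, hom (outcol (top i)) (incol i)
}.

Record twolevel_hom (x y : twolevel) := TwoLevelHom {
  hbot : hom (bot x) (bot y);
  htop : forall i, hom (top i) (@top y (arity_map hbot i));
  hglue : forall i, cmp (outcol_map (htop i)) (@glue y (arity_map hbot i)) =
                    cmp (glue i) (incol_map hbot i)
}.

Definition compose (x : twolevel) : low R := act (@glue x).

Definition compose_map (x y : twolevel) (u : twolevel_hom x y) :
    hom (compose x) (compose y) :=
  act_map (@hglue x y u).

(* The homotopy fibre of the composition functor over r. *)
Record fibre (r : low R) := Fibre {
  fpt : twolevel;
  fpath : hom (compose fpt) r
}.

Definition fibre_hom (r : low R) (x y : fibre r) :=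
  {u : twolevel_hom (fpt x) (fpt y) | cmp (compose_map u) (fpath y) = fpath x}.

(* r |-> sum of a_1 ... a_n (x) b over the homotopy fibre *)
Definition incidence_op (r : low R) : Sym2 (pi0 (upp R)) (pi0 (low R)) :=
  hsum (@fibre_hom r) (fun x =>
    (\prod_(i : arity (bot (fpt x))) tensl _ (gen (cls (top i)))) *
    tensr _ (gen (cls (bot (fpt x))))).

Definition incidence :
    Sym (pi0 (low R)) -> Sym2 (pi0 (upp R)) (pi0 (low R)) :=
  extend (on_classes (@cls (low R)) incidence_op).

End Incidence.

(* The structures below are carried by arbitrary finite types, which form a
   large type.  The isomorphism class of a structure is represented by the set
   of the isomorphic structures ("codes") carried by types ['I_n]. *)
Section IsoClasses.
Variables (code X : Type) (iso : code -> X -> Prop).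

Definition iso_class : choiceType :=
  {P : set code | `[< exists x, P = iso^~ x >]}.

Definition class_of (x : X) : iso_class :=
  exist _ (iso^~ x) (asboolT (ex_intro _ x erefl)).

Lemma class_of_surj (c : iso_class) : exists x, class_of x = c.
Proof.
have /asboolP [x Px] := svalP c.
by exists x; apply: val_inj; rewrite /= -Px.
Qed.

Lemma class_of_eq (x y : X) :
  class_of x = class_of y <-> (forall c, iso c x <-> iso c y).
Proof.
split=> [/(congr1 val) /= E c | E].
  by have := congr1 (@^~ c) E => /= ->.
by apply: val_inj => /=; apply/funext => c; apply/propext.
Qed.
End IsoClasses.

Section Full.
Variables (G : groupoid) (P : G -> bool).

Definition full_gpd : groupoid.
Proof.
refine (@Groupoid {x : G | P x} (fun x y => hom (sval x) (sval y))
         (fun x => idh (sval x)) (fun x y z f g => cmp f g) _ _ _ _).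
- by move=> *; apply: cmpA.
- by move=> *; apply: cmp1l.
- by move=> *; apply: cmp1r.
- by move=> *; apply: cmpV.
Defined.
End Full.

Section FullClassified.
Variables (G : classified) (P : G -> bool).

Definition full_pi0 : choiceType :=
  {c : pi0 G | `[< exists x : full_gpd P, cls (sval x) = c >]}.

Definition full_cls (x : full_gpd P) : full_pi0 :=
  exist _ (cls (sval x)) (asboolT (ex_intro _ x erefl)).

Lemma full_clsP (x y : full_gpd P) :
  full_cls x = full_cls y <-> inhabited (hom x y).
Proof.
split=> [/(congr1 val)/= /clsP //| /clsP E].
exact: val_inj.
Qed.

Lemma full_cls_surj (c : full_pi0) : exists x, full_cls x = c.
Proof.
have /asboolP [x Px] := svalP c.
by exists x; apply: val_inj.
Qed.

Definition full : classified := Classified full_clsP full_cls_surj.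
End FullClassified.

(* A <-src- M -par-> N -tgt-> A *)
Record diagram := Diagram {
  edge : finType;
  mark : finType;
  node : finType;
  src : mark -> edge;
  par : mark -> node;
  tgt : node -> edge
}.

Definition walk (D : diagram) (e : edge D) : edge D :=
  if [pick m | src m == e] is Some m then tgt (par m) else e.

Record otree := OTree {
  diag :> diagram;
  oroot : edge diag;
  tgt_inj : injective (@tgt diag);
  src_inj : injective (@src diag);
  srcP : forall e : edge diag, (e \in codom (@src diag)) = (e != oroot);
  walkP : forall e : edge diag, exists k, iter k (@walk diag) e = oroot
}.

Record diso (D D' : diagram) := DIso {
  fe : edge D -> edge D';
  fm : mark D -> mark D';
  fn : node D -> node D';
  fe_bij : bijective fe;
  fm_bij : bijective fm;
  fn_bij : bijective fn;
  fsrc : forall m, src (fm m) = fe (src m);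
  fpar : forall m, par (fm m) = fn (par m);
  ftgt : forall n, tgt (fn n) = fe (tgt n)
}.

Lemma diso_eq (D D' : diagram) (f g : diso D D') :
  fe f =1 fe g -> fm f =1 fm g -> fn f =1 fn g -> f = g.
Proof.
case: f => a b c p1 p2 p3 q1 q2 q3; case: g => a' b' c' p1' p2' p3' q1' q2' q3' /=.
move=> /funext E1 /funext E2 /funext E3; subst a' b' c'.
by congr DIso; apply: Prop_irrelevance.
Qed.

Definition diso_id (D : diagram) : diso D D.
Proof. by exists id id id => //; exists id. Defined.

Definition diso_comp (D E F : diagram) (f : diso D E) (g : diso E F) : diso D F.
Proof.
exists (fe g \o fe f) (fm g \o fm f) (fn g \o fn f).
- exact: bij_comp (fe_bij g) (fe_bij f).
- exact: bij_comp (fm_bij g) (fm_bij f).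
- exact: bij_comp (fn_bij g) (fn_bij f).
- by move=> m /=; rewrite !fsrc.
- by move=> m /=; rewrite !fpar.
- by move=> m /=; rewrite !ftgt.
Defined.

Lemma diso_inv (D E : diagram) (f : diso D E) :
  exists g : diso E D, diso_comp f g = diso_id D /\ diso_comp g f = diso_id E.
Proof.
have [a aK Ka] := fe_bij f; have [b bK Kb] := fm_bij f; have [c cK Kc] := fn_bij f.
have i1 : forall m, src (b m) = a (src m).
  by move=> m; rewrite -[in RHS](Kb m) fsrc aK.
have i2 : forall m, par (b m) = c (par m).
  by move=> m; rewrite -[in RHS](Kb m) fpar cK.
have i3 : forall n, tgt (c n) = a (tgt n).
  by move=> n; rewrite -[in RHS](Kc n) ftgt aK.
have b1 : bijective a by exists (fe f).
have b2 : bijective b by exists (fm f).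
have b3 : bijective c by exists (fn f).
exists (DIso b1 b2 b3 i1 i2 i3).
by split; apply: diso_eq => x /=.
Qed.

Definition otree_gpd : groupoid.
Proof.
refine (@Groupoid otree (fun T T' => diso T T') (fun T => diso_id T)
          (fun _ _ _ f g => diso_comp f g) _ _ _ _).
- by move=> *; apply: diso_eq.
- by move=> *; apply: diso_eq.
- by move=> *; apply: diso_eq.
- by move=> T T' f; apply: diso_inv.
Defined.

Definition dcode : Type :=
  {n : nat * nat * nat & (('I_n.1.2 -> 'I_n.1.1) * ('I_n.1.2 -> 'I_n.2) *
                          ('I_n.2 -> 'I_n.1.1))%type}.

Definition dcode_diag (c : dcode) : diagram :=
  Diagram (tagged c).1.1 (tagged c).1.2 (tagged c).2.

Lemma dcode_ex (D : diagram) : exists c : dcode, inhabited (diso (dcode_diag c) D).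
Proof.
pose s (m : 'I_#|mark D|) := enum_rank (src (enum_val m)).
pose p (m : 'I_#|mark D|) := enum_rank (par (enum_val m)).
pose t (n : 'I_#|node D|) := enum_rank (tgt (enum_val n)).
exists (existT _ (#|edge D|, #|mark D|, #|node D|) (s, p, t)).
apply: inhabits; exists (@enum_val _ (edge D)) (@enum_val _ (mark D)) (@enum_val _ (node D)).
- exact: enum_val_bij.
- exact: enum_val_bij.
- exact: enum_val_bij.
- by move=> m /=; rewrite /s enum_rankK.
- by move=> m /=; rewrite /p enum_rankK.
- by move=> m /=; rewrite /t enum_rankK.
Qed.

Definition otree_class : otree_gpd -> iso_class _ :=
  @class_of dcode otree_gpd (fun c T => inhabited (diso (dcode_diag c) (diag T))).

Lemma otree_classP (T T' : otree_gpd) :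
  otree_class T = otree_class T' <-> inhabited (hom T T').
Proof.
rewrite class_of_eq; split=> [E | [f] c].
  have [c [f]] := dcode_ex T.
  have /E [g] : inhabited (diso (dcode_diag c) T) by [].
  by have [h _] := diso_inv f; exact: inhabits (diso_comp h g).
split=> -[g]; first exact: inhabits (diso_comp g f).
by have [h _] := diso_inv f; exact: inhabits (diso_comp g h).
Qed.

Definition OTrees : classified := Classified otree_classP (@class_of_surj _ _ _).

Definition nontrivial (T : otree) : bool := (0 < #|node T|)%N.

Definition NTrees : classified := @full OTrees nontrivial.

Definition leaf (T : otree) : finType := {e : edge T | e \notin codom (@tgt T)}.

(* The input edges of a node, each given by its element of M. *)
Definition input (T : otree) (n : node T) : finType := {m : mark T | par m == n}.

Lemma walk_srcI (D : diagram) (m : mark D) :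
  injective (@src D) -> walk (src m) = tgt (par m).
Proof.
move=> sI; rewrite /walk; case: pickP => [m' /eqP /sI -> //| /(_ m)].
by rewrite eqxx.
Qed.

Lemma walk_src (T : otree) (m : mark T) : walk (src m) = tgt (par m).
Proof. exact/walk_srcI/src_inj. Qed.

Lemma walkI (D : diagram) (r : edge D) : injective (@src D) ->
  (forall P : edge D -> Prop,
     P r -> (forall m, P (tgt (par m)) -> P (src m)) -> forall e, P e) ->
  forall e, exists k, iter k (@walk D) e = r.
Proof.
move=> sI; apply=> [|m [k Ek]]; first by exists 0%N.
by exists k.+1; rewrite iterSr walk_srcI.
Qed.

Lemma src_neq_root (T : otree) (m : mark T) : src m != oroot T.
Proof. by rewrite -srcP codom_f. Qed.

Lemma edge_case (T : otree) (e : edge T) :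
  e = oroot T \/ exists m : mark T, e = src m.
Proof.
case: (eqVneq e (oroot T)) => [|ne]; [by left | right].
have h : e \in codom (@src T) by rewrite srcP.
by have /codomP[m ->] := h; exists m.
Qed.

Lemma otree_ind (T : otree) (P : edge T -> Prop) :
  P (oroot T) -> (forall m : mark T, P (tgt (par m)) -> P (src m)) -> forall e, P e.
Proof.
move=> P0 PS e; have [k] := walkP e; elim: k e => [|k IH] e; first by move=> /= ->.
rewrite iterSr; case: (edge_case e) => [-> //| [m ->]].
by rewrite walk_src => /IH /PS.
Qed.

Lemma diso_root (T T' : otree) (f : diso T T') : fe f (oroot T) = oroot T'.
Proof.
apply/eqP/negPn; rewrite -srcP; apply/negP => /codomP [m].
have [g _ K] := fm_bij f; rewrite -[m]K fsrc => /(bij_inj (fe_bij f)) E.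
by have := src_neq_root (g m); rewrite -E eqxx.
Qed.

Lemma nontrivial_root (T : otree) : nontrivial T -> oroot T \in codom (@tgt T).
Proof.
case/card_gt0P => n _.
suff H : forall e : edge T, e \in codom (@tgt T) -> oroot T \in codom (@tgt T).
  exact: (H (tgt n) (codom_f _ _)).
by apply: otree_ind => // m IH _; apply: IH; apply: codom_f.
Qed.

Lemma diso_tgt (T T' : otree) (f : diso T T') (e : edge T) :
  (fe f e \in codom (@tgt T')) = (e \in codom (@tgt T)).
Proof.
apply/codomP/codomP => -[n].
  have [g _ K] := fn_bij f; rewrite -[n]K ftgt => /(bij_inj (fe_bij f)) E.
  by exists (g n).
by move->; exists (fn f n); rewrite ftgt.
Qed.

Lemma leaf_map_proof (T T' : otree) (f : diso T T') (l : leaf T) :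
  fe f (val l) \notin codom (@tgt T').
Proof. by rewrite diso_tgt (valP l). Qed.

Definition leaf_map (T T' : otree) (f : diso T T') (l : leaf T) : leaf T' :=
  exist _ (fe f (val l)) (leaf_map_proof f l).

Lemma input_map_proof (T T' : otree) (f : diso T T') (n : node T) (m : input n) :
  par (fm f (val m)) == fn f n.
Proof. by rewrite fpar (eqP (valP m)). Qed.

Definition input_map (T T' : otree) (f : diso T T') (n : node T) (m : input n) :
    input (fn f n) :=
  exist _ (fm f (val m)) (input_map_proof f m).

Lemma inj_surj_bij (A B : Type) (f : A -> B) :
  injective f -> (forall y, exists x, f x = y) -> bijective f.
Proof.
move=> fI fS; pose g y := projT1 (cid (fS y)).
have K : cancel g f by move=> y; rewrite /g; case: cid.
by exists g => // x; apply: fI; rewrite K.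
Qed.

Lemma leaf_map_bij (T T' : otree) (f : diso T T') : bijective (leaf_map f).
Proof.
apply: inj_surj_bij => [l l' /(congr1 val) /= E | l].
  by apply: val_inj; apply: (bij_inj (fe_bij f)) E.
have [g _ K] := fe_bij f.
have h : g (val l) \notin codom (@tgt T) by rewrite -(diso_tgt f) K (valP l).
by exists (exist _ (g (val l)) h); apply: val_inj => /=; rewrite K.
Qed.

Lemma input_map_bij (T T' : otree) (f : diso T T') (n : node T) :
  bijective (@input_map _ _ f n).
Proof.
apply: inj_surj_bij => [m m' /(congr1 val) /= E | m].
  by apply: val_inj; apply: (bij_inj (fm_bij f)) E.
have [g _ K] := fm_bij f.
have h : par (g (val m)) == n.
  by rewrite -(inj_eq (bij_inj (fn_bij f))) -fpar K (valP m).
by exists (exist _ (g (val m)) h); apply: val_inj => /=; rewrite K.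
Qed.

Definition bool_case (c : bool) : {c} + {~~ c} :=
  if c return {c} + {~~ c} then left isT else right isT.

Section Graft.
Variables (b : otree) (a : leaf b -> otree).

Definition inode_edge : finType := {e : edge b | e \in codom (@tgt b)}.

(* Each leaf l of b is identified with the root edge of a l: the edges are the
   non-leaf edges of b and all the edges of the trees a l. *)
Definition graft_edge : finType := (inode_edge + {l : leaf b & edge (a l)})%type.

Definition graft_emb (e : edge b) : graft_edge :=
  match bool_case (e \in codom (@tgt b)) with
  | left h => inl (exist _ e h)
  | right h => inr (Tagged (fun l => edge (a l)) (oroot (a (exist _ e h))))
  end.

Definition graft_emb_top (l : leaf b) (e : edge (a l)) : graft_edge :=
  inr (Tagged (fun l => edge (a l)) e).

Definition graft_diag : diagram :=
  @Diagram graft_edge (mark b + {l : leaf b & mark (a l)})%type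
    (node b + {l : leaf b & node (a l)})%type
    (fun m => match m with
              | inl m => graft_emb (src m)
              | inr (existT l m) => graft_emb_top (src m)
              end)
    (fun m => match m with
              | inl m => inl (par m)
              | inr (existT l m) => inr (existT _ l (par m))
              end)
    (fun n => match n with
              | inl n => graft_emb (tgt n)
              | inr (existT l n) => graft_emb_top (tgt n)
              end).

Lemma graft_emb_inner (e : edge b) (h : e \in codom (@tgt b)) :
  graft_emb e = inl (exist _ e h).
Proof.
rewrite /graft_emb; case: bool_case => h'; last by case/negP: (h').
by congr inl; apply: val_inj.
Qed.

Lemma graft_emb_leaf (l : leaf b) : graft_emb (val l) = graft_emb_top (oroot (a l)).
Proof.
rewrite /graft_emb; case: bool_case => h'; first by case/negP: (valP l).
by have -> : exist _ (val l) h' = l by apply: val_inj.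
Qed.

Lemma leaf_case (e : edge b) :
  (exists h : e \in codom (@tgt b), graft_emb e = inl (exist _ e h)) \/
  exists l : leaf b, e = val l.
Proof.
case: (bool_case (e \in codom (@tgt b))) => h; [left | right].
  by exists h; rewrite graft_emb_inner.
by exists (exist _ e h).
Qed.

Lemma graft_emb_top_inj (l l' : leaf b) (e : edge (a l)) (e' : edge (a l')) :
  graft_emb_top e = graft_emb_top e' ->
  Tagged (fun l => edge (a l)) e = Tagged (fun l => edge (a l)) e'.
Proof. by case. Qed.

Lemma graft_emb_inj : injective graft_emb.
Proof.
move=> e e'; case: (leaf_case e) => [[h ->] | [l ->]];
  case: (leaf_case e') => [[h' ->] | [l' ->]]; rewrite ?graft_emb_leaf //.
  by case.
by move=> /graft_emb_top_inj /(congr1 tag) /= ->.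
Qed.

Lemma graft_emb_top_src (e : edge b) (l : leaf b) (m : mark (a l)) :
  graft_emb e <> graft_emb_top (src m).
Proof.
case: (leaf_case e) => [[h ->] // | [l' ->]].
rewrite graft_emb_leaf => /graft_emb_top_inj E.
have El : l' = l by have := congr1 tag E.
subst l'; have /eqP := eq_from_Tagged E.
by rewrite eq_sym (negPf (src_neq_root m)).
Qed.

Lemma graft_tgt_inj : injective (@tgt graft_diag).
Proof.
move=> [n|[l n]] [n'|[l' n']] /=; rewrite ?(graft_emb_inner (codom_f _ _)) //.
  by case=> /tgt_inj ->.
move=> /graft_emb_top_inj E; have El : l = l' by have := congr1 tag E.
by subst l'; rewrite (tgt_inj (eq_from_Tagged E)).
Qed.

Lemma graft_src_inj : injective (@src graft_diag).
Proof.
move=> [m|[l m]] [m'|[l' m']] /=.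
- by move=> /graft_emb_inj /src_inj ->.
- by move/graft_emb_top_src.
- by move/esym/graft_emb_top_src.
move=> /graft_emb_top_inj E; have El : l = l' by have := congr1 tag E.
by subst l'; rewrite (src_inj (eq_from_Tagged E)).
Qed.

Lemma graft_srcP (e : edge graft_diag) :
  (e \in codom (@src graft_diag)) = (e != graft_emb (oroot b)).
Proof.
apply/codomP/idP => [[[m|[l m]] ->] /=|/eqP]; first (apply/eqP).
- by move/graft_emb_inj/eqP; rewrite (negPf (src_neq_root m)).
- by apply/eqP => /esym/graft_emb_top_src.
have base (f : edge b) : graft_emb f <> graft_emb (oroot b) ->
    exists m, graft_emb f = @src graft_diag m.
  by case: (edge_case f) => [-> //| [m ->]] _; exists (inl m).
case: e => [[e h]|[l e]] /=.
  by rewrite -graft_emb_inner; apply: base.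
case: (edge_case e) => [->|[m ->] _]; last by exists (inr (existT _ l m)).
by rewrite -[inr _]graft_emb_leaf; apply: base.
Qed.

Lemma graft_walkP (e : edge graft_diag) :
  exists k, iter k (@walk graft_diag) e = graft_emb (oroot b).
Proof.
apply: walkI; first exact: graft_src_inj.
move=> P P0 PS.
have Pb : forall f : edge b, P (graft_emb f).
  by apply: otree_ind => // m Pm; apply: (PS (inl m)).
case=> [[f h]|[l f]]; first by rewrite -graft_emb_inner.
move: f; apply: otree_ind => [|m Pm]; first by rewrite -[inr _]graft_emb_leaf.
exact: (PS (inr (existT _ l m))).
Qed.

Definition graft : otree :=
  @OTree graft_diag (graft_emb (oroot b)) graft_tgt_inj graft_src_inj
    graft_srcP graft_walkP.

End Graft.

Lemma sigma_map_bij (I I' : Type) (B : I -> Type) (B' : I' -> Type)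
    (g : I -> I') (h : forall i, B i -> B' (g i)) :
  bijective g -> (forall i, bijective (h i)) ->
  bijective (fun x : {i : I & B i} => existT B' (g (tag x)) (h (tag x) (tagged x))).
Proof.
move=> [g' gK Kg] hB; apply: inj_surj_bij.
  move=> [i x] [j y] /= E.
  have Ei : i = j by rewrite -(gK i) -(gK j); exact: (congr1 (fun z => g' (tag z)) E).
  subst j; have [h' hK _] := hB i.
  have E' : h i x = h i y.
    have := projT2_eq E; rewrite /= (Prop_irrelevance (projT1_eq E) erefl).
    by [].
  by rewrite -(hK x) -(hK y) E'.
move=> [j y]; move: y; rewrite -(Kg j) => y.
have [h' _ Kh] := hB (g' j).
by exists (existT _ (g' j) (h' y)); rewrite /= Kh.
Qed.

Lemma sum_map_bij (A A' B B' : Type) (f : A -> A') (g : B -> B') :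
  bijective f -> bijective g ->
  bijective (fun x : A + B => match x with inl a => inl (f a) | inr y => inr (g y) end).
Proof.
move=> [f' fK Kf] [g' gK Kg].
exists (fun x => match x with inl a => inl (f' a) | inr y => inr (g' y) end).
  by case=> x; rewrite ?fK ?gK.
by case=> x; rewrite ?Kf ?Kg.
Qed.

Section GraftMap.
Variables (b b' : otree) (a : leaf b -> otree) (a' : leaf b' -> otree).
Variables (u : diso b b') (v : forall l, diso (a l) (a' (leaf_map u l))).

Lemma inode_map_proof (e : inode_edge b) : fe u (val e) \in codom (@tgt b').
Proof. by rewrite diso_tgt (valP e). Qed.

Definition inode_map (e : inode_edge b) : inode_edge b' :=
  exist _ (fe u (val e)) (inode_map_proof e).

Lemma inode_map_bij : bijective inode_map.
Proof.
apply: inj_surj_bij => [l l' /(congr1 val) /= E | l].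
  by apply: val_inj; apply: (bij_inj (fe_bij u)) E.
have [g _ K] := fe_bij u.
have h : g (val l) \in codom (@tgt b) by rewrite -(diso_tgt u) K (valP l).
by exists (exist _ (g (val l)) h); apply: val_inj => /=; rewrite K.
Qed.

Definition graft_map_e (e : edge (graft a)) : edge (graft a') :=
  match e with
  | inl e => inl (inode_map e)
  | inr x => inr (existT (fun l => Finite.sort (edge (a' l))) (leaf_map u (tag x))
                    (fe (v (tag x)) (tagged x)))
  end.

Definition graft_map_m (m : mark (graft a)) : mark (graft a') :=
  match m with
  | inl m => inl (fm u m)
  | inr x => inr (existT (fun l => Finite.sort (mark (a' l))) (leaf_map u (tag x))
                    (fm (v (tag x)) (tagged x)))
  end.

Definition graft_map_n (n : node (graft a)) : node (graft a') :=
  match n with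
  | inl n => inl (fn u n)
  | inr x => inr (existT (fun l => Finite.sort (node (a' l))) (leaf_map u (tag x))
                    (fn (v (tag x)) (tagged x)))
  end.

Lemma graft_map_emb (e : edge b) :
  graft_map_e (graft_emb a e) = graft_emb a' (fe u e).
Proof.
case: (leaf_case a e) => [[h ->] | [l ->]] /=.
  rewrite (graft_emb_inner a' (inode_map_proof (exist _ e h))).
  by congr inl; apply: val_inj.
rewrite graft_emb_leaf /=.
by rewrite -[fe u _]/(val (leaf_map u l)) graft_emb_leaf /= diso_root.
Qed.

Definition graft_map : diso (graft a) (graft a').
Proof.
exists graft_map_e graft_map_m graft_map_n.
- apply: (sum_map_bij inode_map_bij).
  exact: (sigma_map_bij (leaf_map_bij u) (fun l => fe_bij (v l))).
- apply: (sum_map_bij (fm_bij u)).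
  exact: (sigma_map_bij (leaf_map_bij u) (fun l => fm_bij (v l))).
- apply: (sum_map_bij (fn_bij u)).
  exact: (sigma_map_bij (leaf_map_bij u) (fun l => fn_bij (v l))).
- by case=> [m|[l m]]; rewrite /= ?graft_map_emb ?fsrc.
- by case=> [m|[l m]]; rewrite /= fpar.
- by case=> [n|[l n]]; rewrite /= ?graft_map_emb ?ftgt.
Defined.
End GraftMap.

Definition unit_gpd : groupoid.
Proof.
refine (@Groupoid unit (fun _ _ => unit) (fun _ => tt) (fun _ _ _ _ _ => tt)
  _ _ _ _) => // x y []; by [|exists tt].
Defined.

(* The free operad on the terminal operad: one colour, operations the operadic
   trees, inputs the leaves, composition by grafting. *)
Definition free_operad : opaction :=
  @OpAction OTrees OTrees unit_gpd
    leaf (fun b b' u => leaf_map u)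
    (fun _ _ => tt) (fun _ _ _ _ => tt) (fun _ => tt) (fun _ _ _ => tt)
    (fun b a _ => graft a)
    (fun b a _ b' a' _ u v _ => @graft_map b b' a a' u v).

Section Subst.
Variables (K : otree) (a : node K -> otree).
Hypothesis a_nt : forall n, nontrivial (a n).
Variable k : forall n, leaf (a n) -> input n.
Hypothesis k_bij : forall n, bijective (@k n).

Definition inner (T : otree) : finType :=
  {e : edge T | (e != oroot T) && (e \in codom (@tgt T))}.

(* The tree a n replaces the node n: its root edge is identified with the output
   edge of n, and its leaves with the input edges of n by means of k n.  The
   edges are those of K and the inner edges of the trees a n; as each a n has a
   node, the marks are exactly those of the trees a n. *)
Definition subst_edge : finType := (edge K + {n : node K & inner (a n)})%type.

Definition subst_emb (n : node K) (e : edge (a n)) : subst_edge :=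
  match bool_case (e \in codom (@tgt (a n))) with
  | left h =>
    match bool_case (e != oroot (a n)) with
    | left h' => inr (Tagged (fun n => inner (a n))
                        (exist _ e (introT andP (conj h' h)) : inner (a n)))
    | right _ => inl (tgt n)
    end
  | right h => inl (src (val (k (exist _ e h))))
  end.

Definition subst_diag : diagram :=
  @Diagram subst_edge {n : node K & mark (a n)} {n : node K & node (a n)}
    (fun m => subst_emb (src (tagged m)))
    (fun m => existT _ (tag m) (par (tagged m)))
    (fun x => subst_emb (tgt (tagged x))).

Lemma subst_emb_root n : @subst_emb n (oroot (a n)) = inl (tgt n).
Proof.
rewrite /subst_emb; case: bool_case => [h|h].
  by case: bool_case => [h'|//]; case/eqP: (h').
by case/negP: (h); apply: nontrivial_root.
Qed.

Lemma subst_emb_leaf n (l : leaf (a n)) :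
  @subst_emb n (val l) = inl (src (val (k l))).
Proof.
rewrite /subst_emb; case: bool_case => [h|h]; first by case/negP: (valP l).
by have -> : exist _ (val l) h = l by apply: val_inj.
Qed.

Lemma subst_emb_inner n (e : inner (a n)) :
  @subst_emb n (val e) = inr (Tagged (fun n => inner (a n)) e).
Proof.
have /andP[h1 h2] := valP e.
rewrite /subst_emb; case: bool_case => [h|h]; last by case/negP: (h).
case: bool_case => [h'|h']; last by case/negP: (h').
by congr (inr (Tagged _ _)); apply: val_inj.
Qed.

Lemma subst_case n (e : edge (a n)) :
  [\/ e = oroot (a n), exists l : leaf (a n), e = val l |
      exists i : inner (a n), e = val i].
Proof.
case: (bool_case (e \in codom (@tgt (a n)))) => h.
  case: (eqVneq e (oroot (a n))) => [|h']; first by constructor 1.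
  have hh : (e != oroot (a n)) && (e \in codom (@tgt (a n))) by rewrite h' h.
  by constructor 3; exists (exist _ e hh).
by constructor 2; exists (exist _ e h).
Qed.

Lemma leaf_neq_root n (l : leaf (a n)) : val l <> oroot (a n).
Proof. by move=> E; have := valP l; rewrite E (nontrivial_root (a_nt n)). Qed.

Lemma leaf_neq_tgt (T : otree) (l : leaf T) (x : node T) : tgt x <> val l.
Proof. by move=> E; have := valP l; rewrite -E codom_f. Qed.

Lemma inner_neq_root (T : otree) (i : inner T) : val i <> oroot T.
Proof. by move=> E; have := valP i; rewrite E eqxx. Qed.

Lemma inr_inj (A B : Type) (x y : B) : inr x = inr y :> A + B -> x = y.
Proof. by case. Qed.

Lemma subst_tgt_inj : injective (@tgt subst_diag).
Proof.
move=> [n x] [n' x'] /=.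
case: (subst_case (tgt x)) => [E|[l E]|[i E]]; [| by case: (leaf_neq_tgt E) |];
case: (subst_case (tgt x')) => [E'|[l' E']|[i' E']]; try by case: (leaf_neq_tgt E').
- rewrite E E' !subst_emb_root => -[] /tgt_inj En; subst n'.
  by move: E'; rewrite -E => /tgt_inj ->.
- by rewrite E E' subst_emb_root subst_emb_inner.
- by rewrite E E' subst_emb_root subst_emb_inner.
rewrite E E' !subst_emb_inner => H.
have {H}Ei := inr_inj H.
have En : n = n' by have := congr1 tag Ei.
subst n'; have {}Ei := eq_from_Tagged Ei; subst i'.
by move: E'; rewrite -E => /tgt_inj ->.
Qed.

Lemma subst_src_inj : injective (@src subst_diag).
Proof.
have nr n (m : mark (a n)) : src m <> oroot (a n) by apply/eqP/src_neq_root.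
move=> [n x] [n' x'] /=.
case: (subst_case (src x)) => [E|[l E]|[i E]]; [by case: (nr _ _ E) | |];
case: (subst_case (src x')) => [E'|[l' E']|[i' E']]; try by case: (nr _ _ E').
- rewrite E E' !subst_emb_leaf => -[] /src_inj Em.
  have En : n = n' := etrans (esym (eqP (valP (k l))))
    (etrans (congr1 (@par K) Em) (eqP (valP (k l')))).
  subst n'; have /(bij_inj (k_bij n)) El := val_inj Em; subst l'.
  by move: E'; rewrite -E => /src_inj ->.
- by rewrite E E' subst_emb_leaf subst_emb_inner.
- by rewrite E E' subst_emb_leaf subst_emb_inner.
rewrite E E' !subst_emb_inner => H.
have {H}Ei := inr_inj H.
have En : n = n' by have := congr1 tag Ei.
subst n'; have {}Ei := eq_from_Tagged Ei; subst i'.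
by move: E'; rewrite -E => /src_inj ->.
Qed.

Lemma subst_src_leaf (m : mark K) :
  exists x : mark (a (par m)),
    exists l : leaf (a (par m)), src x = val l /\ val (k l) = m.
Proof.
have [g _ kK] := k_bij (par m).
pose l := g (exist _ m (eqxx _)); case: (edge_case (val l)) => [E | [x E]].
  by case: (leaf_neq_root E).
by exists x, l; rewrite E kK.
Qed.

Lemma subst_srcP (e : edge subst_diag) :
  (e \in codom (@src subst_diag)) = (e != inl (oroot K)).
Proof.
apply/codomP/idP => [[[n x] ->] /=|/eqP].
  case: (subst_case (src x)) => [E|[l ->]|[i ->]].
  - by case/eqP: (src_neq_root x).
  - by rewrite subst_emb_leaf; apply/eqP => -[] /eqP; apply/negP/src_neq_root.
  - by rewrite subst_emb_inner.
case: e => [e|[n i]] h.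
  case: (edge_case e) => [E|[m ->]]; first by rewrite E in h.
  have [x [l [E <-]]] := subst_src_leaf m.
  by exists (existT _ (par m) x); rewrite /= E subst_emb_leaf.
case: (edge_case (val i)) => [/inner_neq_root //|[x E]].
by exists (existT _ n x); rewrite /= -E subst_emb_inner.
Qed.

Lemma subst_walkP (e : edge subst_diag) :
  exists j, iter j (@walk subst_diag) e = inl (oroot K).
Proof.
apply: walkI; first exact: subst_src_inj.
move=> P P0 PS.
have Pa n : P (inl (tgt n)) -> forall f : edge (a n), P (subst_emb f).
  move=> Pn; apply: otree_ind => [|m Pm]; first by rewrite subst_emb_root.
  exact: (PS (existT _ n m)).
have PK : forall f : edge K, P (inl f).
  apply: otree_ind => // m /Pa Pm.
  by have [x [l [_ <-]]] := subst_src_leaf m; rewrite -subst_emb_leaf.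
case=> [f|[n i]]; first exact: PK.
by rewrite -[inr _]subst_emb_inner; apply: Pa.
Qed.

Definition subst : otree :=
  @OTree subst_diag (inl (oroot K)) subst_tgt_inj subst_src_inj
    subst_srcP subst_walkP.

Lemma subst_nontrivial : nontrivial K -> nontrivial subst.
Proof.
case/card_gt0P => n _; have /card_gt0P[x _] := a_nt n.
by apply/card_gt0P; exists (existT _ n x).
Qed.

End Subst.

Section SubstMap.
Variables (K K' : otree) (a : node K -> otree) (a' : node K' -> otree).
Hypothesis a_nt : forall n, nontrivial (a n).
Hypothesis a_nt' : forall n, nontrivial (a' n).
Variable k : forall n, leaf (a n) -> input n.
Variable k' : forall n, leaf (a' n) -> input n.
Hypothesis k_bij : forall n, bijective (@k n).
Hypothesis k_bij' : forall n, bijective (@k' n).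
Variables (u : diso K K') (v : forall n, diso (a n) (a' (fn u n))).
Hypothesis vk : forall n (l : leaf (a n)),
  k' (leaf_map (v n) l) = input_map u (k l).

Lemma inner_map_proof (T T' : otree) (f : diso T T') (e : inner T) :
  (fe f (val e) != oroot T') && (fe f (val e) \in codom (@tgt T')).
Proof.
by rewrite diso_tgt -(diso_root f) (inj_eq (bij_inj (fe_bij f))) (valP e).
Qed.

Definition inner_map (T T' : otree) (f : diso T T') (e : inner T) : inner T' :=
  exist _ (fe f (val e)) (inner_map_proof f e).

Lemma inner_map_bij (T T' : otree) (f : diso T T') : bijective (inner_map f).
Proof.
apply: inj_surj_bij => [l l' /(congr1 val) /= E | l].
  by apply: val_inj; apply: (bij_inj (fe_bij f)) E.
have [g _ Kg] := fe_bij f.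
have h : (g (val l) != oroot T) && (g (val l) \in codom (@tgt T)).
  by rewrite -(diso_tgt f) -(inj_eq (bij_inj (fe_bij f))) diso_root Kg (valP l).
by exists (exist _ (g (val l)) h); apply: val_inj => /=; rewrite Kg.
Qed.

Let S := subst a_nt k_bij.
Let S' := subst a_nt' k_bij'.

Definition subst_map_e (e : edge S) : edge S' :=
  match e with
  | inl e => inl (fe u e)
  | inr x => inr (existT (fun n => Finite.sort (inner (a' n))) (fn u (tag x))
                    (inner_map (v (tag x)) (tagged x)))
  end.

Definition subst_map_m (x : mark S) : mark S' :=
  existT (fun n => Finite.sort (mark (a' n))) (fn u (tag x))
    (fm (v (tag x)) (tagged x)).

Definition subst_map_n (x : node S) : node S' :=
  existT (fun n => Finite.sort (node (a' n))) (fn u (tag x))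
    (fn (v (tag x)) (tagged x)).

Lemma subst_map_emb n (e : edge (a n)) :
  subst_map_e (subst_emb k e) = subst_emb k' (fe (v n) e).
Proof.
case: (subst_case e) => [->|[l ->]|[i ->]].
- by rewrite (subst_emb_root a_nt) diso_root (subst_emb_root a_nt') /= ftgt.
- rewrite subst_emb_leaf -[fe _ _]/(val (leaf_map (v n) l)) subst_emb_leaf.
  by rewrite vk /= fsrc.
by rewrite subst_emb_inner -[fe _ _]/(val (inner_map (v n) i)) subst_emb_inner.
Qed.

Definition subst_map : diso S S'.
Proof.
exists subst_map_e subst_map_m subst_map_n.
- apply: (sum_map_bij (fe_bij u)).
  exact: (sigma_map_bij (fn_bij u) (fun n => inner_map_bij (v n))).
- exact: (sigma_map_bij (fn_bij u) (fun n => fm_bij (v n))).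
- exact: (sigma_map_bij (fn_bij u) (fun n => fn_bij (v n))).
- by case=> n m /=; rewrite subst_map_emb fsrc.
- by case=> n m; rewrite /= /subst_map_n /= fpar.
- by case=> n x /=; rewrite subst_map_emb ftgt.
Defined.
End SubstMap.

Lemma sval_inj (T : Type) (P : T -> Prop) : injective (@sval T P).
Proof.
move=> [x p] [y q] /= E; subst y.
by congr exist; apply: Prop_irrelevance.
Qed.

(* Finite sets and bijections.  A finite set L stands for the corolla with leaf
   set L: an isomorphism of corollas is a bijection between the leaf sets. *)
Definition corollas : groupoid.
Proof.
refine (@Groupoid finType (fun L L' : finType => {f : L -> L' | bijective f})
  (fun L => exist _ id (Bijective (fun=> erefl) (fun=> erefl)))
  (fun _ _ _ f g => exist _ (sval g \o sval f) (bij_comp (svalP g) (svalP f)))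
  _ _ _ _).
- by move=> *; apply: sval_inj.
- by move=> *; apply: sval_inj.
- by move=> *; apply: sval_inj.
move=> L L' [f [g fK gK]].
exists (exist _ g (Bijective gK fK)).
by split; apply: sval_inj; apply/funext.
Defined.

Definition leaf_iso (T T' : otree) (f : diso T T') :
    @hom corollas (leaf T) (leaf T') :=
  exist _ (leaf_map f) (leaf_map_bij f).

Definition input_iso (T T' : otree) (f : diso T T') (n : node T) :
    @hom corollas (input n) (input (fn f n)) :=
  exist _ (@input_map _ _ f n) (input_map_bij f n).

Section BaezDolan.

Definition bd_act (K : otree) (a : node K -> NTrees)
    (k : forall n, @hom corollas (leaf (sval (a n))) (input n)) : otree :=
  @subst K (fun n => sval (a n)) (fun n => svalP (a n)) (fun n => sval (k n))
    (fun n => svalP (k n)).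

Lemma bd_act_nontrivial K a k : nontrivial K -> nontrivial (@bd_act K a k).
Proof. exact: subst_nontrivial. Qed.

Lemma bd_square (K K' : otree) (a : node K -> NTrees) (a' : node K' -> NTrees)
    (k : forall n, @hom corollas (leaf (sval (a n))) (input n))
    (k' : forall n, @hom corollas (leaf (sval (a' n))) (input n))
    (u : diso K K') (v : forall n, diso (sval (a n)) (sval (a' (fn u n)))) :
  (forall n, cmp (leaf_iso (v n)) (k' (fn u n)) = cmp (k n) (input_iso u n)) ->
  forall n (l : leaf (sval (a n))),
    sval (k' (fn u n)) (leaf_map (v n) l) = input_map u (sval (k n) l).
Proof. by move=> E n l; have /(congr1 (fun f => sval f l)) := E n. Qed.

Definition bd_act_map (K K' : otree) (a : node K -> NTrees) k
    (a' : node K' -> NTrees) k' (u : diso K K')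
    (v : forall n, diso (sval (a n)) (sval (a' (fn u n))))
    (E : forall n, cmp (leaf_iso (v n)) (k' (fn u n)) = cmp (k n) (input_iso u n)) :
    diso (@bd_act K a k) (@bd_act K' a' k') :=
  @subst_map K K' _ _ _ _ _ _ _ _ u v (bd_square E).

End BaezDolan.

(* The reduced Baez-Dolan construction on the terminal operad: colours the
   corollas, operations the nontrivial operadic trees, inputs the nodes. *)
Definition bd_operad : opaction :=
  @OpAction NTrees NTrees corollas
    (fun K => node (sval K)) (fun K K' u => fn u)
    (fun K n => input n) (fun K K' u n => input_iso u n)
    (fun T => leaf (sval T)) (fun T T' f => leaf_iso f)
    (fun K a k => exist _ (bd_act k) (bd_act_nontrivial k (svalP K)))
    (fun K a k K' a' k' u v E => @bd_act_map (sval K) (sval K') a k a' k' u v E).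

(* All operadic trees, with the operations of the reduced Baez-Dolan construction
   substituted into their nodes. *)
Definition bd_action : opaction :=
  @OpAction OTrees NTrees corollas
    (fun K => node K) (fun K K' u => fn u)
    (fun K n => input n) (fun K K' u n => input_iso u n)
    (fun T => leaf (sval T)) (fun T T' f => leaf_iso f)
    (fun K a k => bd_act k)
    (fun K a k K' a' k' u v E => @bd_act_map K K' a k a' k' u v E).

Record rgraph := RGraph {
  vtx : finType;
  adj : rel vtx;
  rroot : vtx
}.

Definition cut_edge (V : finType) (e : rel V) (x y : V) : rel V :=
  fun u v => e u v && ([set u; v] != [set x; y]).

(* A finite connected simple graph, in which no edge lies on a circuit. *)
Record rtree := RTree {
  rgr :> rgraph;
  adj_sym : symmetric (@adj rgr);
  adj_irr : irreflexive (@adj rgr);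
  adj_conn : forall x y : vtx rgr, connect (@adj rgr) x y;
  adj_acyc : forall x y : vtx rgr, adj x y -> ~~ connect (cut_edge (@adj rgr) x y) x y
}.

Definition riso (G G' : rgraph) : Prop :=
  exists f : vtx G -> vtx G', [/\ bijective f,
    (forall x y, adj (f x) (f y) = adj x y) & f (rroot G) = rroot G'].

Lemma riso_sym (G G' : rgraph) : riso G G' -> riso G' G.
Proof.
case=> f [[g fK gK] fa fr]; exists g; split; first by exists f.
  by move=> x y; rewrite -fa !gK.
by rewrite -fr fK.
Qed.

Lemma riso_trans (G1 G2 G3 : rgraph) : riso G1 G2 -> riso G2 G3 -> riso G1 G3.
Proof.
move=> [f [fB fa fr]] [g [gB ga gr]]; exists (g \o f); split.
- exact: bij_comp.
- by move=> x y /=; rewrite ga fa.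
- by rewrite /= fr.
Qed.

Definition rcode : Type := {n : nat & (rel 'I_n * 'I_n)%type}.

Definition rcode_graph (c : rcode) : rgraph :=
  @RGraph 'I_(tag c) (tagged c).1 (tagged c).2.

Lemma rcode_ex (G : rgraph) : exists c : rcode, riso (rcode_graph c) G.
Proof.
pose e (x y : 'I_#|vtx G|) := adj (enum_val x) (enum_val y).
exists (existT _ #|vtx G| (e, enum_rank (rroot G))).
by exists enum_val; split=> //=; [exact: enum_val_bij | rewrite enum_rankK].
Qed.

Definition RTrees : choiceType :=
  iso_class (fun c (T : rtree) => riso (rcode_graph c) T).

Definition rclass (T : rtree) : RTrees := class_of _ T.

Lemma rclassP (T T' : rtree) : rclass T = rclass T' <-> riso T T'.
Proof.
rewrite class_of_eq; split=> [E | i c].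
  have [c cT] := rcode_ex T.
  exact: riso_trans (riso_sym cT) (proj1 (E c) cT).
by split=> [|/riso_trans]; [move/riso_trans; apply | apply; apply: riso_sym].
Qed.

Lemma connect_ind (V : finType) (e : rel V) (P : V -> Prop) (x : V) :
  P x -> (forall y z, P y -> e y z -> P z) -> forall y, connect e x y -> P y.
Proof.
move=> Px PS y /connectP[p]; elim: p x Px => [|z p IH] x Px /=.
  by move=> _ ->.
by case/andP=> exz; apply: IH; apply: PS exz.
Qed.

Lemma cut_edgeC (V : finType) (e : rel V) (x y : V) : cut_edge e x y = cut_edge e y x.
Proof. by apply/funext => u; apply/funext => v; rewrite /cut_edge [[set y; x]]setUC. Qed.

Lemma cut_edge_sym (V : finType) (e : rel V) (x y : V) :
  symmetric e -> symmetric (cut_edge e x y).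
Proof. by move=> eS u v; rewrite /cut_edge eS [[set v; u]]setUC. Qed.

Section Core.
Variable T : otree.
Hypothesis T_nt : nontrivial T.

(* y is the parent of x: the output edge of x is an input edge of y *)
Definition child (x y : node T) : bool :=
  [exists m : mark T, (src m == tgt x) && (par m == y)].

Definition core_graph : rgraph :=
  @RGraph (node T) (fun x y => child x y || child y x) (iinv (nontrivial_root T_nt)).

Lemma childP x y : reflect (tgt x <> oroot T /\ walk (tgt x) = tgt y) (child x y).
Proof.
apply: (iffP existsP) => [[m /andP[/eqP E /eqP <-]]|[ne E]].
  by rewrite -E walk_src; split=> //; apply/eqP/src_neq_root.
case: (edge_case (tgt x)) => [//|[m Em]].
exists m; rewrite -Em eqxx /=; apply/eqP/(@tgt_inj T).
by rewrite -E Em walk_src.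
Qed.

Lemma walk_oroot : walk (oroot T) = oroot T.
Proof.
rewrite /walk; case: pickP => // m /eqP E.
by have := src_neq_root m; rewrite E eqxx.
Qed.

Lemma walk_cycle (e : edge T) (n : nat) : iter n.+1 (@walk T) e = e -> e = oroot T.
Proof.
move=> E; have [j Ej] := walkP e.
have W i : iter i (@walk T) (oroot T) = oroot T.
  by elim: i => //= i ->; rewrite walk_oroot.
have E' : iter (j * n.+1) (@walk T) e = e.
  by elim: j {Ej} => // j IH; rewrite mulSn iterD IH.
by rewrite -E' -[(_ * _)%N](@subnK j) ?leq_pmulr // iterD Ej W.
Qed.

Lemma core_sym : symmetric (@adj core_graph).
Proof. by move=> x y; rewrite /= orbC. Qed.

Lemma core_irr : irreflexive (@adj core_graph).
Proof.
move=> x /=; rewrite orbb; apply/childP => -[ne E].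
exact: ne (@walk_cycle _ 0 E).
Qed.

Lemma core_conn (x y : vtx core_graph) : connect (@adj core_graph) x y.
Proof.
have H : forall e : edge T, forall z : node T, tgt z = e ->
    connect (@adj core_graph) z (rroot core_graph).
  apply: otree_ind => [z E|m IH z E].
    have -> // : z = rroot core_graph.
    by apply: (@tgt_inj T); rewrite /= f_iinv.
  apply: connect_trans (IH _ erefl); apply: connect1 => /=.
  by apply/orP; left; apply/existsP; exists m; rewrite E !eqxx.
apply: connect_trans (H _ x erefl) _.
by rewrite (sym_connect_sym core_sym); apply: H.
Qed.

Lemma core_acyc_child (x y : node T) : child x y ->
  ~~ connect (cut_edge (@adj core_graph) x y) x y.
Proof.
move=> cxy; have /childP[ne Exy] := cxy; apply/negP => H.
suff [k Ek] : exists k, iter k (@walk T) (tgt y) = tgt x.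
  by apply: ne; apply: (@walk_cycle _ k); rewrite iterSr Exy.
apply: (connect_ind (P := fun z : node T => exists k, iter k (@walk T) (tgt z) = tgt x))
  H => [|z w [k Ek]]; first by exists 0%N.
case/andP=> /= /orP[czw|cwz] ne'; last first.
  by have /childP[_ E] := cwz; exists k.+1; rewrite iterSr E.
have /childP[_ E] := czw; case: k Ek => [/(@tgt_inj T) Ez|k].
  move: ne'; rewrite Ez; have -> : w = y.
    by apply: (@tgt_inj T); rewrite -Exy -E Ez.
  by rewrite eqxx.
by rewrite iterSr E; exists k.
Qed.

Lemma core_acyc (x y : vtx core_graph) :
  adj x y -> ~~ connect (cut_edge (@adj core_graph) x y) x y.
Proof.
case/orP=> [|c]; first exact: core_acyc_child.
rewrite cut_edgeC (sym_connect_sym (cut_edge_sym _ _ core_sym)).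
exact: core_acyc_child.
Qed.

Definition core : rtree := RTree core_sym core_irr core_conn core_acyc.
End Core.

Section Subtrees.
Variable T : rtree.
Implicit Types (B S : {set vtx T}) (P : {set {set vtx T}}).

Definition within B : rel (vtx T) := fun x y => [&& x \in B, y \in B & adj x y].

Definition connected_set B : bool :=
  [forall x in B, forall y in B, connect (within B) x y].

Definition is_subtree B : bool := (B != set0) && connected_set B.

(* The length of a shortest path; it is less than the number of vertices. *)
Definition dist (x y : vtx T) : nat :=
  find (fun n => [exists p : n.-tuple (vtx T), path (@adj T) x p && (last x p == y)])
       (iota 0 #|vtx T|).

Section Induced.
Variable B : {set vtx T}.
Hypothesis hB : is_subtree B.

Lemma subtree_ex : exists x, x \in B.
Proof. by case/andP: hB => /set0Pn. Qed.

Definition top_vertex : vtx T :=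
  [arg min_(x < xchoose subtree_ex | x \in B) dist (rroot T) x].

Lemma top_vertex_in : top_vertex \in B.
Proof. by rewrite /top_vertex; case: arg_minnP => //; apply: xchooseP. Qed.

(* The induced subgraph; its root is the vertex nearest to the root of T. *)
Definition subtree_graph : rgraph :=
  @RGraph {x : vtx T | x \in B} (fun x y => adj (val x) (val y))
    (exist _ top_vertex top_vertex_in).

Lemma subtree_sym : symmetric (@adj subtree_graph).
Proof. by move=> x y; apply: adj_sym. Qed.

Lemma subtree_irr : irreflexive (@adj subtree_graph).
Proof. by move=> x; apply: adj_irr. Qed.

Lemma subtree_conn (x y : vtx subtree_graph) : connect (@adj subtree_graph) x y.
Proof.
have /andP[_ /forall_inP/(_ _ (valP x))/forall_inP/(_ _ (valP y))] := hB.
move=> /(connect_ind (P := fun z => forall h : z \in B,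
    connect (@adj subtree_graph) x (exist _ z h))) H.
have -> : y = exist _ (val y) (valP y) by apply: val_inj.
apply: H => [h|z w IH /and3P[hz hw zw] h].
  by have -> : exist _ (val x) h = x by apply: val_inj.
exact: connect_trans (IH hz) (connect1 _).
Qed.

Lemma subtree_acyc (x y : vtx subtree_graph) :
  adj x y -> ~~ connect (cut_edge (@adj subtree_graph) x y) x y.
Proof.
move=> /adj_acyc; apply: contra.
apply: (connect_ind (P := fun z =>
  connect (cut_edge (@adj T) (val x) (val y)) (val x) (val z))) => // z w IH.
case/andP=> zw ne; apply: connect_trans IH (connect1 _).
rewrite /cut_edge [adj _ _]zw /=; apply: contra ne => /eqP E.
apply/eqP/setP => t; have /setP/(_ (val t)) := E.
by rewrite !inE !(inj_eq val_inj).
Qed.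

Definition subtree : rtree :=
  RTree subtree_sym subtree_irr subtree_conn subtree_acyc.
End Induced.

Definition tree_partition P : bool :=
  partition P [set: vtx T] && [forall B in P, connected_set B].

Section Contraction.
Variable P : {set {set vtx T}}.
Hypothesis hP : tree_partition P.

Lemma pblock_in x : pblock P x \in P.
Proof. by case/andP: hP => /and3P[/eqP c _ _] _; rewrite pblock_mem // c inE. Qed.

Lemma mem_block x : x \in pblock P x.
Proof. by case/andP: hP => /and3P[/eqP c _ _] _; rewrite mem_pblock c inE. Qed.

Lemma block_eq x B : B \in P -> x \in B -> B = pblock P x.
Proof. by case/andP: hP => /and3P[_ t _] _ hB xB; rewrite (def_pblock t hB xB). Qed.

Lemma block_conn B x y : B \in P -> x \in B -> y \in B -> connect (within B) x y.
Proof.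
move=> hB hx hy; have /andP[_ /forall_inP/(_ _ hB)] := hP.
by move=> /forall_inP/(_ _ hx)/forall_inP/(_ _ hy).
Qed.

(* The blocks, two of them being adjacent if joined by an edge of T. *)
Definition contract_graph : rgraph :=
  @RGraph {B : {set vtx T} | B \in P}
    (fun C D => (C != D) && [exists x in val C, exists y in val D, adj x y])
    (exist _ (pblock P (rroot T)) (pblock_in (rroot T))).

Lemma contract_adjP (B C : vtx contract_graph) :
  reflect (B != C /\ exists x y, [/\ x \in val B, y \in val C & adj x y]) (adj B C).
Proof.
apply: (iffP andP) => -[ne H]; split=> //.
  have /exists_inP[x hx /exists_inP[y hy a]] := H; by exists x, y.
case: H => x [y [hx hy a]]; apply/exists_inP; exists x => //.
by apply/exists_inP; exists y.
Qed.

Lemma contract_sym : symmetric (@adj contract_graph).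
Proof.
suff H (B C : vtx contract_graph) : adj B C -> adj C B by move=> B C; apply/idP/idP; apply: H.
case/contract_adjP=> ne [x [y [hx hy a]]]; apply/contract_adjP.
by rewrite eq_sym; split=> //; exists y, x; rewrite adj_sym.
Qed.

Lemma contract_irr : irreflexive (@adj contract_graph).
Proof. by move=> B; rewrite /= eqxx. Qed.

Lemma contract_conn (B C : vtx contract_graph) : connect (@adj contract_graph) B C.
Proof.
pose b x : vtx contract_graph := exist _ (pblock P x) (pblock_in x).
have bE (D : vtx contract_graph) x : x \in val D -> D = b x.
  by move=> h; apply: val_inj; apply: block_eq => //; apply: valP.
have H x y : connect (@adj contract_graph) (b x) (b y).
  apply: (connect_ind (P := fun y => connect (@adj contract_graph) (b x) (b y)))
    (adj_conn x y) => // {}y z IH a; apply: connect_trans IH _.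
  case: (eqVneq (b y) (b z)) => [-> //|ne]; apply: connect1; apply/contract_adjP.
  by split=> //; exists y, z; split=> //; apply: mem_block.
have nz (D : vtx contract_graph) : exists x, x \in val D.
  apply/set0Pn; apply: contraTneq (valP D) => ->.
  by case/andP: hP => /and3P[].
have [x /bE ->] := nz B; have [y /bE ->] := nz C; exact: H.
Qed.

Lemma contract_acyc (B C : vtx contract_graph) :
  adj B C -> ~~ connect (cut_edge (@adj contract_graph) B C) B C.
Proof.
have uniqB (D E : vtx contract_graph) x : x \in val D -> x \in val E -> D = E.
  move=> hD hE; apply: val_inj.
  by rewrite (block_eq (valP D) hD) (block_eq (valP E) hE).
case/contract_adjP=> ne [x [y [hx hy a]]]; apply/negP => H.
have /negP := adj_acyc a; apply.
have inside (D : vtx contract_graph) u v : u \in val D -> v \in val D ->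
    connect (cut_edge (@adj T) x y) u v.
  move=> hu0 hv0; apply: connect_sub (block_conn (valP D) hu0 hv0) => {hu0 hv0 u v}u v.
  case/and3P=> hu hv uv; apply: connect1; rewrite /cut_edge uv /=.
  apply/eqP => /setP E; have := E x; have := E y; rewrite !inE !eqxx orbT /=.
  have yD : y \in val D.
    by have := E y; rewrite !inE eqxx orbT => /orP[] /eqP ->.
  have xD : x \in val D.
    by have := E x; rewrite !inE eqxx => /orP[] /eqP ->.
  by case/eqP: ne; rewrite (uniqB _ _ _ hx xD) (uniqB _ _ _ hy yD).
suff /(_ y hy) : forall z, z \in val C -> connect (cut_edge (@adj T) x y) x z by [].
apply: (connect_ind (P := fun D : vtx contract_graph =>
  forall z, z \in val D -> connect (cut_edge (@adj T) x y) x z)) H => [z|D E IH].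
  exact: inside.
case/andP=> /contract_adjP[_ [u [v [hu hv uv]]]] neDE z hz.
apply: connect_trans (IH u hu) _; apply: connect_trans (inside _ _ _ hv hz).
apply: connect1; rewrite /cut_edge uv /=; apply: contra neDE => /eqP E0.
have /orP[] : (u == x) || (u == y).
- by have /setP/(_ u) := E0; rewrite !inE eqxx.
- move/eqP=> ux; subst u; have -> : D = B by apply: uniqB hu hx.
  have /eqP vy : v == y.
    have /setP/(_ y) := E0; rewrite !inE eqxx orbT => /orP[] /eqP yv; last by rewrite yv.
    by case/eqP: ne; apply: (uniqB _ _ x) => //; rewrite -yv.
  by subst v; have -> : E = C by apply: uniqB hv hy.
move/eqP=> uy; subst u; have -> : D = C by apply: uniqB hu hy.
have /eqP vx : v == x.
  have /setP/(_ x) := E0; rewrite !inE eqxx => /orP[] /eqP xv; last by rewrite xv.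
  by case/eqP: ne; apply: (uniqB _ _ x) => //; rewrite xv.
subst v; have -> : E = B by apply: uniqB hv hx.
by rewrite setUC.
Qed.

Definition contract : rtree :=
  RTree contract_sym contract_irr contract_conn contract_acyc.
End Contraction.

(* Partitions of the vertices into the vertex set of a tree containing the root,
   or the empty set, and its complement. *)
Definition admissible S : bool :=
  (S == set0) || (rroot T \in S) && connected_set S.

Definition components B : {set {set vtx T}} :=
  equivalence_partition (connect (within B)) B.

(* The generator given by the subtree on B; 1 if B is empty. *)
Definition subtree_gen B : Sym RTrees :=
  match bool_case (is_subtree B) with
  | left h => gen (rclass (subtree h))
  | right _ => 1
  end.

(* sum over admissible cuts of P_c (x) R_c *)
Definition butcher_connes_kreimer_tree : Sym2 RTrees RTrees :=
  \sum_(S : {set vtx T} | admissible S)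
    (\prod_(B in components (~: S)) tensl _ (subtree_gen B)) *
    tensr _ (subtree_gen S).

(* sum over partitions into subtrees of (subtrees) (x) (contracted tree) *)
Definition extraction_contraction_tree : Sym2 RTrees RTrees :=
  \sum_(P : {P : {set {set vtx T}} | tree_partition P})
    (\prod_(B in val P) tensl _ (subtree_gen B)) *
    tensr _ (gen (rclass (contract (valP P)))).

End Subtrees.

Definition butcher_connes_kreimer : Sym RTrees -> Sym2 RTrees RTrees :=
  extend (on_classes rclass butcher_connes_kreimer_tree).

Definition extraction_contraction : Sym RTrees -> Sym2 RTrees RTrees :=
  extend (on_classes rclass extraction_contraction_tree).

(* Coaction of the extraction-contraction bialgebra on the Butcher-Connes-Kreimer
   bialgebra; both have the underlying algebra Sym RTrees. *)
Definition extraction_contraction_coaction : Sym RTrees -> Sym2 RTrees RTrees := extraction_contraction.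

Definition core_gen (T : otree) : Sym RTrees :=
  match bool_case (nontrivial T) with
  | left h => gen (rclass (core h))
  | right _ => 1
  end.

Definition core_on : pi0 OTrees -> Sym RTrees :=
  on_classes (@cls OTrees) core_gen.

Definition ncore_on : pi0 NTrees -> Sym RTrees :=
  on_classes (@cls NTrees) (fun T => gen (rclass (core (svalP T)))).

Definition core_map : Sym (pi0 OTrees) -> Sym RTrees := extend core_on.
Definition ncore_map : Sym (pi0 NTrees) -> Sym RTrees := extend ncore_on.

(* Main.v *)
Require Import Defs.
From HB Require Import structures.
From mathcomp Require Import boolp classical_sets.
From mathcomp Require Import all_boot all_order all_algebra.
From mathcomp Require Import finmap monalg.

Set Implicit Arguments.
Unset Strict Implicit.
Unset Printing Implicit Defensive.

Import GRing.Theory.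
Local Open Scope ring_scope.

(** The incidence comultiplications are homotopy sums over the fibre of the
    composition of two-level trees over an operadic tree T.  Two facts about the
    fibre turn them into the sums over subsets and partitions that define the
    comultiplications of rooted trees.

    First, the fibre has no nontrivial automorphisms ([graft_map_inj],
    [subst_map_inj]): the pieces of a decomposition of T embed in T, so an
    automorphism over T fixes them.  All weights 1/|Aut| are therefore 1
    ([hsum_classified]).

    Second, the isomorphism class of a decomposition is the set of nodes of T that
    each piece occupies.  For grafting this is the node set of the bottom tree, an
    arbitrary set closed under passing to the parent ([cut_hom], [cut_exists]); for
    substitution it is the partition of the nodes into blobs, an arbitrary
    partition into sets having one topmost member ([blobs_hom], [blobs_exists]).
    Both rest on the same remark: a subtree of T with all its adjacent edges is an
    etale map, and an etale map into a tree is determined by its root edge and its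
    nodes ([etale_iso]).

    It remains to pass to cores.  Closed sets are the admissible cuts and the
    blobs are the connected sets ([admissible_root_closed],
    [tree_partition_blob]); the core of a subtree is the subtree induced on its
    nodes ([node_image_riso]); the trees grafted above a cut are the components of
    the complement, the nodeless ones becoming 1 ([components_cut]); and the tree
    into which blobs are substituted has the contracted tree as its core
    ([contract_riso]).

    Both sides of the identities are algebra maps, hence are compared on
    generators ([Sym_ext]).  On a generator the definitions evaluate at some
    representative of an isomorphism class, so the core of T has to be replaced by
    an arbitrary rooted tree R isomorphic to it; this is the role of the
    isomorphism th, along which sets of nodes are carried.  Surjectivity holds
    because a rooted tree R is the core of the operadic tree with the same
    nodes and no leaves ([upward_core]). *)

(** * Algebra maps out of polynomial algebras *)

Section Extend.
Variables (X : choiceType) (A : comAlgType rat) (F : X -> A).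

Let mon (m : {cmonom X}) : A := \prod_(x <- finsupp m) F x ^+ m x.

Lemma mon_widen (m : {cmonom X}) (E : {fset X}) :
  (finsupp m `<=` E)%fset -> mon m = \prod_(x <- E) F x ^+ m x.
Proof.
move=> le; rewrite /mon (big_fset_incl _ le) // => x _.
by rewrite -cmE_neq0 negbK => /eqP ->.
Qed.

Lemma mon_mmorphism : mmorphism mon.
Proof.
split=> [m1 m2|]; last by rewrite /mon mdom1 big_seq_fset0.
rewrite (@mon_widen m1 (finsupp m1 `|` finsupp m2)%fset) ?fsubsetUl //.
rewrite (@mon_widen m2 (finsupp m1 `|` finsupp m2)%fset) ?fsubsetUr //.
rewrite /mon mdomD -big_split; apply: eq_bigr => x _.
by rewrite cmM exprD.
Qed.

HB.instance Definition _ := isMultiplicative.Build {cmonom X} A mon mon_mmorphism.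

Lemma extendM : {morph extend F : x y / x * y}.
Proof. exact: (rmorphM (mmap (in_alg A) mon)). Qed.

Lemma extend1 : extend F 1 = 1.
Proof. exact: (rmorph1 (mmap (in_alg A) mon)). Qed.

Lemma extendB : {morph extend F : x y / x - y}.
Proof. exact: (raddfB (mmap (in_alg A) mon)). Qed.

Lemma extendZ (c : rat) : {morph extend F : x / c *: x}.
Proof. by move=> x; rewrite /extend (@mmapZ _ _ _ _ mon) /= mulr_algl. Qed.

Lemma extend_gen (x : X) : extend F (gen x) = F x.
Proof.
rewrite /extend /gen mmapU /= scale1r mul1r mdomU big_seq_fset1 cmUU.
by rewrite expr1.
Qed.

End Extend.

HB.instance Definition _ (X : choiceType) (A : comAlgType rat) (F : X -> A) :=
  GRing.isZmodMorphism.Build _ _ (@extend X A F) (@extendB X A F).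
HB.instance Definition _ (X : choiceType) (A : comAlgType rat) (F : X -> A) :=
  GRing.isMonoidMorphism.Build _ _ (@extend X A F) (@extend1 X A F, @extendM X A F).
HB.instance Definition _ (X : choiceType) (A : comAlgType rat) (F : X -> A) :=
  GRing.isScalable.Build rat _ _ _ (@extend X A F) (@extendZ X A F).

Lemma malgU_mul (M : monomType) (m1 m2 : M) :
  << mmul m1 m2 >> = << m1 >> * << m2 >> :> {malg rat[M]}.
Proof.
by rewrite malgME !msuppU oner_eq0 !big_seq_fset1 !mcoeffUU mulr1.
Qed.

Lemma malgU_scale (M : monomType) (c : rat) (m : M) :
  << c *g m >> = c *: << m >> :> {malg rat[M]}.
Proof. by apply/malgP => k; rewrite mcoeffZ !mcoeffU mulrnAr mulr1. Qed.

Definition mono (X : choiceType) (m : {cmonom X}) : Sym X := << m >>.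

Lemma monoM (X : choiceType) (a b : {cmonom X}) : mono (mmul a b) = mono a * mono b.
Proof. exact: malgU_mul. Qed.

(** Induction on the degree of a monomial, splitting off one generator at a
    time, and linearity. *)
Lemma Sym_ext (X : choiceType) (A : comAlgType rat) (f g : {lrmorphism Sym X -> A}) :
  (forall x, f (gen x) = g (gen x)) -> f =1 g.
Proof.
move=> E y.
have step a b : f a = g a -> f b = g b -> f (a * b) = g (a * b).
  by move=> Ea Eb; rewrite !rmorphM /= Ea Eb.
have monE (m : {cmonom X}) : f (mono m) = g (mono m).
  elim: {m}(mdeg m).+1 {-2}m (ltnSn (mdeg m)) => // n IH m.
  case: (eqVneq m mone) => [-> _|].
    by rewrite -[mono _]/(1 : Sym X) !rmorph1.
  rewrite -mdeg_eq0 mdegE => ne lt.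
  have [x mx] : exists x, m x != 0%N.
    apply/not_existsP => H; case/eqP: ne; rewrite big1 // => x _.
    by apply/eqP/negPn/negP/H.
  have Em : m = mmul (ucm x) (divcm m (ucm x)).
    apply/eqP/cmP => z; rewrite cmM cmU divcmE cmU.
    by case: eqP => [<-|]; rewrite ?subn0 // subnKC // lt0n.
  rewrite Em monoM; apply: step; first exact: E.
  by apply: IH; move: lt; rewrite -mdegE [X in mdeg X]Em mdegM mdegU.
rewrite [y]monalgE !raddf_sum; apply: eq_bigr => m _ /=.
have -> : << y@_m *g m >> = y@_m *: mono m.
  exact: malgU_scale.
by rewrite !linearZ /= monE.
Qed.

(** * Sums over groupoids without automorphisms *)

Section Extend2.
Variables (X Y X' Y' : choiceType) (F : X -> Sym X') (G : Y -> Sym Y').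

Lemma extend2_tensl x : extend2 F G (tensl Y (gen x)) = tensl Y' (F x).
Proof. by rewrite /extend2 /tensl !extend_gen. Qed.

Lemma extend2_tensr y : extend2 F G (tensr X (gen y)) = tensr X' (G y).
Proof. by rewrite /extend2 /tensr !extend_gen. Qed.

Lemma extend2_term (I : finType) (a : I -> X) (b : Y) :
  extend2 F G ((\prod_i tensl Y (gen (a i))) * tensr X (gen b)) =
  (\prod_i tensl Y' (F (a i))) * tensr X' (G b).
Proof.
rewrite /extend2 rmorphM rmorph_prod /= -/(extend2 F G _) extend2_tensr.
by congr (_ * _); apply: eq_bigr => i _; apply: extend2_tensl.
Qed.

End Extend2.

Lemma ncard1 (T : Type) : inhabited T -> (forall x y : T, x = y) -> ncard T = 1%N.
Proof.
move=> [x] T1; rewrite /ncard; case: xgetP => [n _ [f fB]|/(_ 1%N)[]]; last first.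
  exists (fun=> x), (fun=> ord0) => y; last exact: T1.
  exact/esym/ord1.
have [g gK Kg] := fB; rewrite -(card_ord n); apply: (@eq_card1 _ (g x)) => i.
by rewrite !inE; apply/esym/eqP; rewrite -[i]gK; congr g; apply: T1.
Qed.

(** Every weight is 1, and the representatives that enter the sum are in
    bijection with the classifying set I.  The summands are described by g only
    after the linear map L, here the passage to cores. *)
Lemma hsum_classified (X : Type) (H : X -> X -> Type) (V W : lmodType rat)
    (f : X -> V) (L : {linear V -> W}) (I : finType) (inv : X -> I) (g : I -> W) :
  (forall x y, inhabited (H x y) <-> inv x = inv y) ->
  (forall i, exists x, inv x = i) ->
  (forall x (u v : H x x), u = v) ->
  (forall x, L (f x) = g (inv x)) ->
  L (hsum H f) = \sum_i g i.
Proof.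
move=> Hinv inv_surj H1 Lf.
have w1 x : (ncard (H x x))%:R^-1 = 1 :> rat.
  by rewrite ncard1 ?invr1 //; apply/Hinv.
rewrite /hsum; case: xgetP => [_ _ [n [s [sP ->]]]|nex]; last first.
  pose s (i : 'I_#|I|) := projT1 (cid (inv_surj (enum_val i))).
  have sE i : inv (s i) = enum_val i by rewrite /s; case: cid.
  case: (nex (\sum_(i < #|I|) (ncard (H (s i) (s i)))%:R^-1 *: f (s i))).
  exists #|I|, s; split=> // x; exists (enum_rank (inv x)); split.
    by apply/Hinv; rewrite sE enum_rankK.
  by move=> j /Hinv E; rewrite E sE enum_valK.
rewrite linear_sum [RHS](reindex (fun i => inv (s i))) /=.
  by apply: eq_bigr => i _; rewrite w1 scale1r Lf.
apply: onW_bij; apply: inj_surj_bij => [i j E|i].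
  have [k [_ ku]] := sP (s i).
  by rewrite -(ku i) ?(ku j) //; apply/Hinv.
have [x <-] := inv_surj i; have [j [/Hinv E _]] := sP x.
by exists j; rewrite E.
Qed.

Lemma on_classesP (X C : Type) (cl : X -> C) (V : zmodType) (f : X -> V) (x : X) :
  exists2 y, cl y = cl x & on_classes cl f (cl x) = f y.
Proof.
rewrite /on_classes; case: xgetP => [_ _ [y [E ->]]|/(_ (f x))[]]; first by exists y.
by exists x.
Qed.

Lemma on_classesE (X C : Type) (cl : X -> C) (V : zmodType) (f : X -> V) (x : X) :
  (forall y, cl y = cl x -> f y = f x) -> on_classes cl f (cl x) = f x.
Proof. by move=> E; have [y /E <-] := on_classesP cl f x. Qed.


(** * Depth of edges *)

Lemma depth_ex (T : otree) (e : edge T) :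
  exists k, iter k (@walk T) e == oroot T.
Proof. by have [k /eqP] := walkP e; exists k. Qed.

Definition depth (T : otree) (e : edge T) : nat := ex_minn (depth_ex e).

Lemma depth_root (T : otree) : depth (oroot T) = 0%N.
Proof.
by rewrite /depth; case: ex_minnP => k _ /(_ 0%N (eqxx _)); rewrite leqn0 => /eqP.
Qed.

Lemma depth_src (T : otree) (m : mark T) :
  depth (src m) = (depth (tgt (par m))).+1.
Proof.
rewrite /depth; case: ex_minnP => -[|k]; first by rewrite /= (negPf (src_neq_root m)).
rewrite iterSr walk_src => E min; case: ex_minnP => l El minl; congr _.+1.
apply/eqP; rewrite eqn_leq minl // andbT -ltnS; apply: min.
by rewrite iterSr walk_src.
Qed.

Lemma child_depth (T : otree) (x y : node T) :
  child x y -> depth (tgt x) = (depth (tgt y)).+1.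
Proof. by case/existsP=> m /andP[/eqP <- /eqP <-]; apply: depth_src. Qed.

Lemma child_src (T : otree) (m : mark T) (x : node T) :
  tgt x = src m -> child x (par m).
Proof. by move=> E; apply/existsP; exists m; rewrite E !eqxx. Qed.

Lemma child_fun (T : otree) (x y z : node T) : child x y -> child x z -> y = z.
Proof.
case/existsP=> m /andP[/eqP E /eqP <-] /existsP[m' /andP[/eqP E' /eqP <-]].
by congr par; apply: (@src_inj T); rewrite E.
Qed.

Definition rootnode (T : otree) (h : nontrivial T) : node T :=
  iinv (nontrivial_root h).

Lemma tgt_rootnode (T : otree) (h : nontrivial T) : tgt (rootnode h) = oroot T.
Proof. exact: f_iinv. Qed.

(** * Subtrees as etale maps *)

(** The inclusion of a subtree with all the edges adjacent to its nodes: a map of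
    diagrams that is bijective on the inputs of each node.  Injectivity on edges
    and nodes is a consequence ([ee_inj], [en_inj]), as the codomain is a tree. *)
Record etale (A T : otree) := Etale {
  ee : edge A -> edge T;
  em : mark A -> mark T;
  en : node A -> node T;
  em_src : forall m, src (em m) = ee (src m);
  em_par : forall m, par (em m) = en (par m);
  en_tgt : forall n, tgt (en n) = ee (tgt n);
  em_linj : forall m m', par m = par m' -> em m = em m' -> m = m';
  em_surj : forall n m, par m = en n -> exists2 m', par m' = n & em m' = m
}.

Section Etale.
Variables (A T : otree) (j : etale A T).

Lemma ee_above (e : edge A) :
  e = oroot A \/ (depth (ee j (oroot A)) < depth (ee j e))%N.
Proof.
elim/otree_ind: e => [|m IH]; [by left | right].
rewrite -em_src depth_src em_par en_tgt.
by case: IH => [->|/ltnW].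
Qed.

Lemma ee_inj : injective (ee j).
Proof.
elim/otree_ind => [e' E|m IH e'].
  by case: (ee_above e') => // ; rewrite -E ltnn.
case: (edge_case e') => [-> E|[m' ->]].
  by case: (ee_above (src m)) => // ; rewrite E ltnn.
rewrite -!em_src => /src_inj Em; have En := congr1 (@par T) Em.
rewrite !em_par in En; have := congr1 (@tgt T) En.
by rewrite !en_tgt => /IH /tgt_inj Ep; rewrite (em_linj Ep Em).
Qed.

Lemma en_inj : injective (en j).
Proof.
by move=> n n' /(congr1 (@tgt T)); rewrite !en_tgt => /ee_inj /tgt_inj.
Qed.

Lemma em_inj : injective (em j).
Proof.
by move=> n n' /(congr1 (@src T)); rewrite !em_src => /ee_inj /src_inj.
Qed.

Lemma en_child (x y : node A) : child (en j x) (en j y) = child x y.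
Proof.
apply/existsP/existsP => -[m /andP[/eqP E /eqP P]].
  have [m' Pm Em] := em_surj P; exists m'.
  by rewrite Pm eqxx -(inj_eq ee_inj) -em_src Em E en_tgt eqxx.
by exists (em j m); rewrite em_src E en_tgt em_par P !eqxx.
Qed.

Lemma en_parent (x : node A) (y : node T) :
  tgt x <> oroot A -> child (en j x) y -> exists z, y = en j z.
Proof.
move=> ne c; case: (edge_case (tgt x)) => // -[m Em].
exists (par m); apply: (child_fun c).
by rewrite en_child child_src.
Qed.

End Etale.

Definition etale_diso (T T' : otree) (f : diso T T') : etale T T'.
Proof.
exists (fe f) (fm f) (fn f).
- exact: fsrc.
- exact: fpar.
- exact: ftgt.
- by move=> m m' _; apply: bij_inj (fm_bij f) _ _.
move=> n m E; have [g gK Kg] := fm_bij f; exists (g m) => //.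
by apply: (bij_inj (fn_bij f)); rewrite -E -fpar Kg.
Defined.

Definition etale_comp (A B T : otree) (i : etale A B) (j : etale B T) : etale A T.
Proof.
exists (ee j \o ee i) (em j \o em i) (en j \o en i) => /=.
- by move=> m; rewrite !em_src.
- by move=> m; rewrite !em_par.
- by move=> n; rewrite !en_tgt.
- by move=> m m' _ /em_inj /em_inj.
by move=> n m /em_surj[m' /em_surj[m'' <- <-] <-]; exists m''.
Defined.

Lemma bij_over (X Y Z : Type) (i : X -> Z) (j : Y -> Z) :
  injective i -> injective j ->
  (forall x, exists y, j y = i x) -> (forall y, exists x, i x = j y) ->
  {f : X -> Y | bijective f & forall x, j (f x) = i x}.
Proof.
move=> iI jI ij ji; pose f x := projT1 (cid (ij x)).
have fE x : j (f x) = i x by rewrite /f; case: cid.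
exists f => //; apply: inj_surj_bij => [x x' E|y].
  by apply: iI; rewrite -!fE E.
by have [x E] := ji y; exists x; apply: jI; rewrite fE.
Qed.

Lemma etale_edge_sub (A A' T : otree) (i : etale A T) (j : etale A' T) :
  ee i (oroot A) = ee j (oroot A') ->
  (forall n, exists n', en j n' = en i n) ->
  (forall e, exists e', ee j e' = ee i e) /\ (forall m, exists m', em j m' = em i m).
Proof.
move=> Er En.
have Em m : exists m', em j m' = em i m.
  have [n' E] := En (par m); rewrite -em_par in E.
  by have [m' _ <-] := em_surj (esym E); exists m'.
split=> // e; elim/otree_ind: e => [|m _]; first by exists (oroot A').
by have [m' E] := Em m; exists (src m'); rewrite -!em_src E.
Qed.

(** The nodes determine the marks by etaleness, and all edges but the root edge
    carry a mark; so i and j have the same image on edges, marks and nodes, and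
    by injectivity one factors through the other.  The root edge is given
    separately because the trivial tree has an embedding at each edge of T. *)
Lemma etale_iso (A A' T : otree) (i : etale A T) (j : etale A' T) :
  ee i (oroot A) = ee j (oroot A') ->
  (forall n, exists n', en j n' = en i n) ->
  (forall n', exists n, en i n = en j n') ->
  {f : diso A A' | (forall e, ee j (fe f e) = ee i e) &
                   (forall n, en j (fn f n) = en i n)}.
Proof.
move=> Er En En'; have [Ee Em] := etale_edge_sub Er En.
have [Ee' Em'] := etale_edge_sub (esym Er) En'.
have [a aB aE] := bij_over (@ee_inj _ _ i) (@ee_inj _ _ j) Ee Ee'.
have [b bB bE] := bij_over (@em_inj _ _ i) (@em_inj _ _ j) Em Em'.
have [c cB cE] := bij_over (@en_inj _ _ i) (@en_inj _ _ j) En En'.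
have H1 m : src (b m) = a (src m).
  by apply: (@ee_inj _ _ j); rewrite aE -em_src bE em_src.
have H2 m : par (b m) = c (par m).
  by apply: (@en_inj _ _ j); rewrite cE -em_par bE em_par.
have H3 n : tgt (c n) = a (tgt n).
  by apply: (@ee_inj _ _ j); rewrite aE -en_tgt cE en_tgt.
by exists (DIso aB bB cB H1 H2 H3).
Qed.

Lemma diso_eq_edge (T T' : otree) (f g : diso T T') : fe f =1 fe g -> f = g.
Proof.
move=> E; apply: diso_eq => // [m|n].
  by apply: (@src_inj T'); rewrite !fsrc E.
by apply: (@tgt_inj T'); rewrite !ftgt E.
Qed.

(** The root edge of a subtree with nodes is the output edge of its node of least
    depth. *)
Lemma etale_root_eq (A A' T : otree) (i : etale A T) (j : etale A' T) :
  nontrivial A -> nontrivial A' ->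
  (forall n, exists n', en j n' = en i n) ->
  (forall n', exists n, en i n = en j n') ->
  ee i (oroot A) = ee j (oroot A').
Proof.
move=> h h' En En'; have [x Ex] := En' (rootnode h'); have [y Ey] := En (rootnode h).
have := congr1 (@tgt T) Ex; have := congr1 (@tgt T) Ey; rewrite !en_tgt !tgt_rootnode.
move=> {Ex Ey}Ey Ex.
case: (ee_above i (tgt x)) => [<- //|]; case: (ee_above j (tgt y)) => [<- //|].
by rewrite Ex Ey => /ltn_trans lt /lt; rewrite ltnn.
Qed.

(** * Building subtrees *)

(** The hypotheses on S and r say that S lies above the edge r and contains, with
    a node, every node on the way down to r. *)
Section Subtree.
Variables (T : otree) (S : pred (node T)) (r : edge T).
Hypothesis Sup : forall n, S n -> tgt n = r \/ exists2 m, src m = tgt n & S (par m).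
Hypothesis Sr : forall m, S (par m) -> src m <> r.

Definition sub_edge : pred (edge T) :=
  fun e => (e == r) || [exists m, (src m == e) && S (par m)].

Lemma sub_edgeP e :
  reflect (e = r \/ exists2 m, src m = e & S (par m)) (sub_edge e).
Proof.
apply: (iffP orP) => -[/eqP|H]; [by left | | by left | right].
  by case/existsP: H => m /andP[/eqP E h]; right; exists m.
by case: H => m /eqP E h; apply/existsP; exists m; rewrite E.
Qed.

Lemma sub_src (m : {m : mark T | S (par m)}) : sub_edge (src (val m)).
Proof. by apply/sub_edgeP; right; exists (val m); [|exact: (valP m)]. Qed.

Lemma sub_tgt (n : {n : node T | S n}) : sub_edge (tgt (val n)).
Proof. by apply/sub_edgeP; apply: Sup; apply: (valP n). Qed.

Lemma sub_rootP : sub_edge r. Proof. by rewrite /sub_edge eqxx. Qed.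

Definition sub_diag : diagram :=
  @Diagram {e : edge T | sub_edge e} {m : mark T | S (par m)} {n : node T | S n}
    (fun m => Sub (src (val m)) (sub_src m))
    (fun m => Sub (par (val m)) (valP m))
    (fun n => Sub (tgt (val n)) (sub_tgt n)).

Definition sub_root : edge sub_diag := Sub r sub_rootP.

Lemma sub_tgt_inj : injective (@tgt sub_diag).
Proof. by move=> n n' /(congr1 val) /= /tgt_inj /val_inj. Qed.

Lemma sub_src_inj : injective (@src sub_diag).
Proof. by move=> n n' /(congr1 val) /= /src_inj /val_inj. Qed.

Lemma sub_srcP (e : edge sub_diag) : (e \in codom (@src sub_diag)) = (e != sub_root).
Proof.
apply/codomP/idP => [[m ->]|/eqP ne].
  by apply/eqP => /(congr1 val); apply: (Sr (valP m)).
have /sub_edgeP[E|[m E h]] := valP e; first by case: ne; apply: val_inj.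
by exists (Sub m h); apply: val_inj.
Qed.

Lemma sub_walkP (e : edge sub_diag) : exists k, iter k (@walk sub_diag) e = sub_root.
Proof.
apply: walkI; first exact: sub_src_inj.
move=> P P0 PS.
have H : forall (f : edge T) (h : sub_edge f), P (Sub f h).
  elim/otree_ind => [|m IH] h.
    have /sub_edgeP[E|[m E _]] := h; last by have := src_neq_root m; rewrite E eqxx.
    by have -> : Sub (oroot T) h = sub_root by apply: val_inj.
  have /sub_edgeP[E|[m' /src_inj E h']] := h.
    by have -> : Sub (src m) h = sub_root by apply: val_inj.
  subst m'; pose m0 : mark sub_diag := Sub m h'.
  have -> : Sub (src m) h = src m0 by apply: val_inj.
  by apply: PS; apply: IH.
case=> f h; exact: H.
Qed.

Definition subt : otree :=
  @OTree sub_diag sub_root sub_tgt_inj sub_src_inj sub_srcP sub_walkP.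

Definition subt_etale : etale subt T.
Proof.
exists val val val => //.
  by move=> m m' _ /val_inj.
by move=> n m E; have h : S (par m) by [rewrite E (valP n)];
   exists (Sub m h) => //; apply: val_inj.
Defined.

End Subtree.

Section GraftEtale.
Variables (b : otree) (a : leaf b -> otree).

Definition graft_bot : etale b (graft a).
Proof.
exists (graft_emb a) (fun m => inl m) (fun n => inl n) => //.
  by move=> m m' _ [].
by move=> n [m|[l m]] //= [<-]; exists m.
Defined.

Definition graft_top (l : leaf b) : etale (a l) (graft a).
Proof.
exists (@graft_emb_top b a l) (fun m => inr (Tagged (fun l => mark (a l)) m))
  (fun n => inr (Tagged (fun l => node (a l)) n)) => //.
  by move=> m m' _ E; apply: eq_from_Tagged (Defs.inr_inj E).
move=> n [//|[l' m]] E0; have /= E := Defs.inr_inj E0.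
have El : l' = l by have := congr1 tag E.
by subst l'; exists m; rewrite ?(eq_from_Tagged E).
Defined.

Variables (T : otree) (jb : etale b T) (ja : forall l, etale (a l) T).
Hypothesis jroot : forall l, ee (ja l) (oroot (a l)) = ee jb (val l).

Definition glue_edge (e : edge (graft a)) : edge T :=
  match e with
  | inl e => ee jb (val e)
  | inr x => ee (ja (tag x)) (tagged x)
  end.

Lemma glue_emb (e : edge b) : glue_edge (graft_emb a e) = ee jb e.
Proof.
by case: (leaf_case a e) => [[h ->]|[l ->]] //; rewrite graft_emb_leaf /= jroot.
Qed.

Definition graft_glue : etale (graft a) T.
Proof.
exists glue_edge
  (fun m : mark (graft a) => match m with
    inl m => em jb m | inr x => em (ja (tag x)) (tagged x) end)
  (fun n : node (graft a) => match n with
    inl n => en jb n | inr x => en (ja (tag x)) (tagged x) end).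
- by case=> [m|[l m]] /=; rewrite em_src // glue_emb.
- by case=> [m|[l m]] /=; rewrite em_par.
- by case=> [n|[l n]] /=; rewrite en_tgt // glue_emb.
- case=> [m|[l m]] [m'|[l' m']] //= => [_ /em_inj -> //|E0].
  have E := Defs.inr_inj E0.
  have El : l = l' by have := congr1 tag E.
  by subst l' => /em_inj ->.
case=> [n|[l n]] m /em_surj[m' Pm <-]; first by exists (inl m'); rewrite //= Pm.
by exists (inr (Tagged (fun l => mark (a l)) m')); rewrite //= Pm.
Defined.

Hypothesis jb_root : ee jb (oroot b) = oroot T.
Hypothesis j_cover : forall n, (exists n', en jb n' = n) \/
  exists l n', en (ja l) n' = n.

(** The glued map is etale, hence injective, and the covering hypothesis makes it
    onto on nodes; [etale_iso] compares it with the identity of T. *)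
Lemma graft_glue_iso :
  {f : diso (graft a) T | (forall e, fe f e = ee graft_glue e) &
                          (forall n, fn f n = en graft_glue n)}.
Proof.
have [||n|f fE fN] := @etale_iso _ _ _ graft_glue (etale_diso (diso_id T)); last first.
- by exists f.
- case: (j_cover n) => [[n' <-]|[l [n' <-]]]; first by exists (inl n').
  by exists (inr (Tagged (fun l => node (a l)) n')).
- by move=> n; exists (en graft_glue n).
exact: etrans (glue_emb _) jb_root.
Qed.

End GraftEtale.

(** * Cuts *)

(** The node sets of the bottom trees of cuts.  The empty set is the cut across
    the root edge, whose bottom tree is trivial. *)
Definition root_closed (T : otree) (S : {set node T}) : bool :=
  [forall x in S, forall y, child x y ==> (y \in S)].

Lemma root_closedP (T : otree) (S : {set node T}) :
  reflect (forall x y, x \in S -> child x y -> y \in S) (root_closed S).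
Proof.
apply: (iffP forall_inP) => H x; first by move=> y /H /forallP/(_ y)/implyP.
by move=> Sx; apply/forallP => y; apply/implyP; apply: H.
Qed.

Section Cut.
Variables (T b : otree) (a : leaf b -> otree) (f : diso (graft a) T).

Definition cut_bot : etale b T := etale_comp (graft_bot a) (etale_diso f).
Definition cut_top l : etale (a l) T := etale_comp (@graft_top b a l) (etale_diso f).

Definition cut : {set node T} := [set en cut_bot n | n : node b].

Lemma cut_bot_root : ee cut_bot (oroot b) = oroot T.
Proof. exact: (diso_root f). Qed.

Lemma cut_top_root l : ee (cut_top l) (oroot (a l)) = ee cut_bot (val l).
Proof. by rewrite /= graft_emb_leaf. Qed.

Lemma cut_closed : root_closed cut.
Proof.
apply/root_closedP => _ y /imsetP[n _ ->] c.
suff [z ->] : exists z, y = en cut_bot z by apply: imset_f.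
apply: (en_parent _ c) => E; have /childP[] := c.
by rewrite en_tgt E cut_bot_root.
Qed.

Lemma cut_topN l n : en (cut_top l) n \notin cut.
Proof. by apply/imsetP => -[n' _ /= /(bij_inj (fn_bij f))]. Qed.

Lemma cut_topP n : n \notin cut -> exists l n', n = en (cut_top l) n'.
Proof.
have [g gK Kg] := fn_bij f; rewrite -[n]Kg; case: (g n) => [n'|[l n'] _].
  by case/negP; apply/imsetP; exists n'.
by exists l, n'.
Qed.

Lemma cut_top_disj l l' e e' : ee (cut_top l) e = ee (cut_top l') e' -> l = l'.
Proof. by move/(bij_inj (fe_bij f))/graft_emb_top_inj/(congr1 tag). Qed.

End Cut.

Section CutHom.
Variables (T b b' : otree) (a : leaf b -> otree) (a' : leaf b' -> otree).
Variables (f : diso (graft a) T) (f' : diso (graft a') T).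
Hypothesis Ecut : cut f = cut f'.

Lemma cut_bot_sub n : exists n', en (cut_bot f') n' = en (cut_bot f) n.
Proof.
have : en (cut_bot f) n \in cut f by apply: imset_f.
by rewrite Ecut => /imsetP[n' _ ->]; exists n'.
Qed.

(** By induction along the tree above l: the next node is outside the cut, hence
    in one of the trees above the leaves for f', and the edge through which it is
    reached shows that this tree is the one above l'. *)
Lemma cut_top_sub l l' :
  ee (cut_top f l) (oroot (a l)) = ee (cut_top f' l') (oroot (a' l')) ->
  forall n, exists n', en (cut_top f' l') n' = en (cut_top f l) n.
Proof.
move=> Er.
have Hn n : (exists e', ee (cut_top f' l') e' = ee (cut_top f l) (tgt n)) ->
    exists n', en (cut_top f' l') n' = en (cut_top f l) n.
  case=> e' Ee; have := cut_topN f n; rewrite Ecut => /cut_topP[l2 [n2 En]].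
  have El : l2 = l'.
    by apply: (@cut_top_disj _ _ _ f' _ _ (tgt n2) e'); rewrite -en_tgt -En en_tgt Ee.
  by subst l2; exists n2.
suff H e : exists e', ee (cut_top f' l') e' = ee (cut_top f l) e by move=> n; apply: Hn.
elim/otree_ind: e => [|m /Hn[n' En]]; first by exists (oroot (a' l')).
rewrite -em_par in En; have [m' _ Em] := em_surj (esym En).
by exists (src m'); rewrite -!em_src Em.
Qed.

End CutHom.

(** The bottom trees have the same nodes and the root edge of T as root edge;
    matching leaves are the same edge of T, and the tree above a leaf consists of
    all that lies above that edge ([cut_top_sub]). *)
Lemma cut_hom (T b b' : otree) (a : leaf b -> otree) (a' : leaf b' -> otree)
    (f : diso (graft a) T) (f' : diso (graft a') T) :
  cut f = cut f' ->
  exists (u : diso b b') (v : forall l, diso (a l) (a' (leaf_map u l))),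
    diso_comp (graft_map v) f' = f.
Proof.
move=> E.
have [u uE _] : {u : diso b b' |
    (forall e, ee (cut_bot f') (fe u e) = ee (cut_bot f) e) &
    (forall n, en (cut_bot f') (fn u n) = en (cut_bot f) n)}.
  apply: etale_iso; first by rewrite !cut_bot_root.
    exact: cut_bot_sub.
  exact/cut_bot_sub/esym.
have Er l : ee (cut_top f l) (oroot _) = ee (cut_top f' (leaf_map u l)) (oroot _).
  by rewrite !cut_top_root -uE.
have V l : {v : diso (a l) (a' (leaf_map u l)) |
    (forall e, ee (cut_top f' (leaf_map u l)) (fe v e) = ee (cut_top f l) e) &
    (forall n, en (cut_top f' (leaf_map u l)) (fn v n) = en (cut_top f l) n)}.
  apply: etale_iso => //; first exact: cut_top_sub.
  exact/cut_top_sub/esym/Er/esym.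
exists u, (fun l => s2val (V l)); apply: diso_eq_edge => -[[e h]|[l e]] /=.
  have := uE e; rewrite /= -(graft_map_emb (fun l => s2val (V l))).
  by rewrite (graft_emb_inner _ h).
exact: (s2valP (V l)).
Qed.

Lemma cut_hom_eq (T b b' : otree) (a : leaf b -> otree) (a' : leaf b' -> otree)
    (f : diso (graft a) T) (f' : diso (graft a') T)
    (u : diso b b') (v : forall l, diso (a l) (a' (leaf_map u l))) :
  diso_comp (graft_map v) f' = f -> cut f = cut f'.
Proof.
move=> <-; apply/setP => n; apply/imsetP/imsetP => -[n' _ ->] /=.
  by exists (fn u n').
by have [g _ K] := fn_bij u; exists (g n'); rewrite //= K.
Qed.

(** Both the bottom tree and the trees above it embed in the grafting.  The pair
    is stated as an equality of dependent pairs, as the type of v depends on u. *)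
Lemma graft_map_inj (b b' : otree) (a : leaf b -> otree) (a' : leaf b' -> otree)
    (u u' : diso b b') (v : forall l, diso (a l) (a' (leaf_map u l)))
    (v' : forall l, diso (a l) (a' (leaf_map u' l))) :
  graft_map v = graft_map v' ->
  existT (fun u => forall l, diso (a l) (a' (leaf_map u l))) u v = existT _ u' v'.
Proof.
move=> E; have Eu : u = u'.
  apply: diso_eq_edge => e; apply: (@graft_emb_inj _ a').
  have := congr1 (fun g : diso (graft a) (graft a') => fe g (graft_emb a e)) E.
  by rewrite /= !graft_map_emb.
subst u'; congr existT; apply: functional_extensionality_dep => l.
apply: diso_eq_edge => e.
have := congr1 (fun g : diso (graft a) (graft a') => fe g (graft_emb_top e)) E.
by move=> E'; apply: eq_from_Tagged (Defs.inr_inj E').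
Qed.

(** * Every root-closed set of nodes is a cut *)

Definition above (T : otree) (r : edge T) (n : node T) : bool :=
  fconnect (@walk T) (tgt n) r.

Lemma above_src (T : otree) (r : edge T) (m : mark T) (n : node T) :
  tgt n = src m -> above r (par m) -> above r n.
Proof.
move=> E; rewrite /above E => h; apply: connect_trans h; apply: connect1.
by rewrite /= walk_src.
Qed.

Section CutExists.
Variables (T : otree) (S : {set node T}).
Hypothesis Scl : root_closed S.

Let bS := fun n : node T => n \in S.

Lemma bot_up n : bS n -> tgt n = oroot T \/ exists2 m, src m = tgt n & bS (par m).
Proof.
move=> h; case: (edge_case (tgt n)) => [->|[m E]]; [by left | right].
by exists m => //; move/root_closedP: Scl; apply; [exact: h | exact: child_src].
Qed.

Lemma bot_root m : bS (par m) -> src m <> oroot T.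
Proof. by move=> _; apply/eqP/src_neq_root. Qed.

Let b := subt bot_up bot_root.

Lemma top_up (r : edge T) (n : node T) : above r n ->
  tgt n = r \/ exists2 m, src m = tgt n & above r (par m).
Proof.
rewrite /above fconnect_eqVf => /orP[/eqP|h]; first by left.
have [E|[m E]] := edge_case (tgt n); last first.
  by right; exists m => //; rewrite E walk_src in h.
left; rewrite E; move: h; rewrite E walk_oroot => /iter_findex <-.
by elim: findex => //= k <-; rewrite walk_oroot.
Qed.

Lemma top_root (r : edge T) (m : mark T) : above r (par m) -> src m <> r.
Proof.
rewrite /above -walk_src => /iter_findex E Em.
have := src_neq_root m; rewrite Em in E *.
by rewrite (@walk_cycle _ r (findex (@walk T) (walk r) r)) ?eqxx // iterSr E.
Qed.

Let a (l : leaf b) := subt (@top_up (val (val l))) (@top_root (val (val l))).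

(** The bottom tree has the chosen nodes; above each of its leaves sits the tree
    of all nodes above that edge.  Walking up from the root edge, one leaves S
    only through a leaf of the bottom tree, so these trees cover T. *)
Lemma cut_exists : exists (b : otree) (a : leaf b -> otree) (f : diso (graft a) T),
  cut f = S.
Proof.
exists b, a.
have cover e : forall n, tgt n = e ->
    n \in S \/ exists l : leaf b, above (val (val l)) n.
  elim/otree_ind: e => [|m IH] n E; (case: (boolP (n \in S)) => [|nS]; [by left|right]).
    (* A node at the root edge outside S: as S is closed, the bottom tree is
       trivial and its only edge is a leaf. *)
    have h : oroot b \notin codom (@tgt b).
      apply/codomP => -[n' /(congr1 val) /= E']; case/negP: nS.
      by have -> : n = val n' by [apply: (@tgt_inj T); rewrite E E']; apply: (valP n').
    by exists (Sub (oroot b) h); rewrite /above E /= connect0.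
  case: (IH (par m) erefl) => [mS|[l hl]]; last by exists l; apply: above_src hl.
  pose m' : mark b := Sub m mS.
  have h : src m' \notin codom (@tgt b).
    apply/codomP => -[n' /(congr1 val) /= E']; case/negP: nS.
    by have -> : n = val n' by [apply: (@tgt_inj T); rewrite E E']; apply: (valP n').
  by exists (Sub (src m') h); rewrite /above E /= connect0.
pose jb : etale b T := subt_etale bot_up bot_root.
pose ja l : etale (a l) T :=
  subt_etale (@top_up (val (val l))) (@top_root (val (val l))).
have [|f _ fn] := @graft_glue_iso b a T jb ja (fun=> erefl) erefl.
  move=> n; case: (cover _ n erefl) => [h|[l h]]; first by left; exists (Sub n h).
  by right; exists l, (Sub n h).
exists f; apply/setP => n; apply/imsetP/idP => [[n' _ ->]|h] /=.
  by rewrite fn; apply: (valP n').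
by exists (Sub n h); rewrite //= fn.
Qed.

End CutExists.

Section SubstEtale.
Variables (K : otree) (a : node K -> otree).
Hypothesis a_nt : forall n, nontrivial (a n).
Variable k : forall n, leaf (a n) -> input n.
Hypothesis k_bij : forall n, bijective (@k n).

Definition subst_in (n : node K) : etale (a n) (subst a_nt k_bij).
Proof.
exists (@subst_emb K a k n) (Tagged (fun n => mark (a n)))
  (Tagged (fun n => node (a n))) => //.
  by move=> m m' _; apply: eq_from_Tagged.
move=> x [n' m] E; have En : n' = n by have := congr1 tag E.
by subst n'; exists m; rewrite //= (eq_from_Tagged E).
Defined.

Variables (T : otree) (kE : edge K -> edge T) (ja : forall n, etale (a n) T).
Hypothesis kE_root : forall n, ee (ja n) (oroot (a n)) = kE (tgt n).
Hypothesis kE_leaf : forall n (l : leaf (a n)), ee (ja n) (val l) = kE (src (val (k l))).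

Definition sglue_edge (e : edge (subst a_nt k_bij)) : edge T :=
  match e with
  | inl e => kE e
  | inr x => ee (ja (tag x)) (val (tagged x))
  end.

Lemma sglue_emb n (e : edge (a n)) : sglue_edge (subst_emb k e) = ee (ja n) e.
Proof.
case: (subst_case e) => [->|[l ->]|[i ->]].
- by rewrite subst_emb_root //= kE_root.
- by rewrite subst_emb_leaf /= kE_leaf.
by rewrite subst_emb_inner.
Qed.

Definition subst_glue : etale (subst a_nt k_bij) T.
Proof.
exists sglue_edge
  (fun m : mark (subst a_nt k_bij) => em (ja (tag m)) (tagged m))
  (fun n : node (subst a_nt k_bij) => en (ja (tag n)) (tagged n)).
- by case=> n m /=; rewrite em_src sglue_emb.
- by case=> n m /=; rewrite em_par.
- by case=> n m /=; rewrite en_tgt sglue_emb.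
- move=> [n m] [n' m'] E; have En : n = n' by have := congr1 tag E.
  by subst n' => /em_inj /= ->.
case=> [n x] m /em_surj[m' Pm <-].
by exists (Tagged (fun n => mark (a n)) m'); rewrite //= Pm.
Defined.

Hypothesis kE_oroot : kE (oroot K) = oroot T.
Hypothesis ja_cover : forall x, exists n y, en (ja n) y = x.

(** As for graftings, the glued map is etale, and the covering hypothesis makes
    it onto on nodes. *)
Lemma subst_glue_iso :
  {f : diso (subst a_nt k_bij) T | (forall e, fe f e = ee subst_glue e) &
                                   (forall n, fn f n = en subst_glue n)}.
Proof.
have [|||f fE fN] := @etale_iso _ _ _ subst_glue (etale_diso (diso_id T)).
- exact: kE_oroot.
- by move=> n; exists (en subst_glue n).
- by move=> x; have [n [y <-]] := ja_cover x; exists (Tagged (fun n => node (a n)) y).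
by exists f.
Qed.

End SubstEtale.

(** * Partitions into blobs *)

(** Connectedness phrased through parents, which is the form in which operadic
    trees provide and use it; [treelike_subtree] relates it to paths. *)
Definition treelike (T : otree) (B : {set node T}) : bool :=
  [exists t in B, forall x in B, (x == t) || [exists y in B, child x y]].

Lemma treelikeP (T : otree) (B : {set node T}) :
  reflect (exists2 t, t \in B &
             forall x, x \in B -> x = t \/ exists2 y, y \in B & child x y)
          (treelike B).
Proof.
apply: (iffP exists_inP) => -[t tB H]; exists t => //.
  move=> x xB; have /orP[/eqP|/exists_inP[y]] := forall_inP H x xB; first by left.
  by right; exists y.
apply/forall_inP => x /H[->|[y yB c]]; first by rewrite eqxx.
by apply/orP; right; apply/exists_inP; exists y.
Qed.

Definition blob_partition (T : otree) (P : {set {set node T}}) : bool :=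
  partition P [set: node T] && [forall B in P, treelike B].

Lemma etale_treelike (A T : otree) (j : etale A T) :
  nontrivial A -> treelike [set en j n | n : node A].
Proof.
move=> h; apply/treelikeP; exists (en j (rootnode h)); first exact: imset_f.
move=> _ /imsetP[x _ ->]; case: (edge_case (tgt x)) => [E|[m E]].
  by left; congr en; apply: (@tgt_inj A); rewrite tgt_rootnode.
right; exists (en j (par m)); first exact: imset_f.
by rewrite en_child child_src.
Qed.

Section Blobs.
Variables (T K : otree) (a : node K -> otree).
Variable a_nt : forall n, nontrivial (a n).
Variable k : forall n, leaf (a n) -> input n.
Variable k_bij : forall n, bijective (@k n).
Variable f : diso (subst a_nt k_bij) T.

Definition blob_etale n : etale (a n) T :=
  etale_comp (subst_in a_nt k_bij n) (etale_diso f).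

Definition blob n : {set node T} := [set en (blob_etale n) x | x : node (a n)].

Definition blobs : {set {set node T}} := [set blob n | n : node K].

Definition blob_edge (e : edge K) : edge T := fe f (inl e).

Lemma blob_edge_inj : injective blob_edge.
Proof. by move=> e e' /(bij_inj (fe_bij f)) []. Qed.

Lemma blob_edge_root : blob_edge (oroot K) = oroot T.
Proof. exact: (diso_root f). Qed.

Lemma blob_etale_root n : ee (blob_etale n) (oroot (a n)) = blob_edge (tgt n).
Proof. by rewrite /= subst_emb_root. Qed.

Lemma blob_etale_leaf n (l : leaf (a n)) :
  ee (blob_etale n) (val l) = blob_edge (src (val (k l))).
Proof. by rewrite /= subst_emb_leaf. Qed.

Lemma blob_disj n n' x x' : en (blob_etale n) x = en (blob_etale n') x' -> n = n'.
Proof. by move/(bij_inj (fn_bij f))/(congr1 tag). Qed.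

Lemma blob_inj : injective blob.
Proof.
move=> n n' E; have : en (blob_etale n) (rootnode (a_nt n)) \in blob n by apply: imset_f.
by rewrite E => /imsetP[x' _ /blob_disj].
Qed.

Lemma blob_cover x : exists n y, x = en (blob_etale n) y.
Proof.
have [g gK Kg] := fn_bij f; exists (tag (g x)), (tagged (g x)).
by rewrite /= -[LHS]Kg; case: (g x).
Qed.

Lemma mem_blob n y : (en (blob_etale n) y \in blob n).
Proof. exact: imset_f. Qed.

Lemma blobs_partition : blob_partition blobs.
Proof.
apply/andP; split; last first.
  by apply/forall_inP => _ /imsetP[n _ ->]; apply: etale_treelike.
apply/and3P; split.
- apply/eqP/setP => x; rewrite inE; apply/bigcupP.
  have [n [y ->]] := blob_cover x; exists (blob n); first exact: imset_f.
  exact: mem_blob.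
- apply/trivIsetP => _ _ /imsetP[n _ ->] /imsetP[n' _ ->] ne.
  rewrite -setI_eq0; apply/eqP/setP => x; rewrite !inE; apply/negP.
  case/andP=> /imsetP[y _ ->] /imsetP[y' _ /blob_disj E].
  by rewrite E eqxx in ne.
apply/imsetP => -[n _ /setP/(_ (en (blob_etale n) (rootnode (a_nt n))))].
by rewrite mem_blob inE.
Qed.

End Blobs.

Section BlobHom.
Variables (T K K' : otree) (a : node K -> otree) (a' : node K' -> otree).
Variables (a_nt : forall n, nontrivial (a n)) (a_nt' : forall n, nontrivial (a' n)).
Variables (k : forall n, leaf (a n) -> input n) (k' : forall n, leaf (a' n) -> input n).
Variables (k_bij : forall n, bijective (@k n)) (k_bij' : forall n, bijective (@k' n)).
Variables (f : diso (subst a_nt k_bij) T) (f' : diso (subst a_nt' k_bij') T).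

Section SameBlob.
Variables (n : node K) (n' : node K').
Hypothesis Eb : blob f n = blob f' n'.

Lemma blob_eq_sub x : exists x', en (blob_etale f' n') x' = en (blob_etale f n) x.
Proof. by have := mem_blob f x; rewrite Eb => /imsetP[x' _ ->]; exists x'. Qed.

Lemma blob_eq_sub' x' : exists x, en (blob_etale f n) x = en (blob_etale f' n') x'.
Proof. by have := mem_blob f' x'; rewrite -Eb => /imsetP[x _ ->]; exists x. Qed.

Lemma blob_eq_root :
  ee (blob_etale f n) (oroot (a n)) = ee (blob_etale f' n') (oroot (a' n')).
Proof. by apply: etale_root_eq => //; [apply: blob_eq_sub | apply: blob_eq_sub']. Qed.

Lemma blob_eq_iso : {v : diso (a n) (a' n') |
  forall e, ee (blob_etale f' n') (fe v e) = ee (blob_etale f n) e}.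
Proof.
have [v vE _] := etale_iso blob_eq_root blob_eq_sub blob_eq_sub'.
by exists v.
Qed.

End SameBlob.

(** An input edge m of a node of K is a leaf of the tree substituted there; the
    corresponding leaf of the tree occupying the same blob for f' is the same
    edge of T. *)
Lemma blob_mark_sub :
  (forall n, exists n', blob f' n' = blob f n) ->
  forall m, exists2 m', blob_edge f' (src m') = blob_edge f (src m) &
                        blob f' (par m') = blob f (par m).
Proof.
move=> Eb m; have [n' En] := Eb (par m); have [v vE] := blob_eq_iso (esym En).
have [x [l [_ El]]] := subst_src_leaf a_nt k_bij m.
exists (val (k' (leaf_map v l))); last by rewrite (eqP (valP (k' (leaf_map v l)))).
by rewrite -blob_etale_leaf vE blob_etale_leaf El.
Qed.

End BlobHom.

Lemma blobs_sub (T K K' : otree) (a : node K -> otree) (a' : node K' -> otree)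
    a_nt a_nt' k k' k_bij k_bij'
    (f : diso (@subst K a a_nt k k_bij) T) (f' : diso (@subst K' a' a_nt' k' k_bij') T) :
  blobs f = blobs f' -> forall n, exists n', blob f' n' = blob f n.
Proof.
move=> E n; have : blob f n \in blobs f by apply: imset_f.
by rewrite E => /imsetP[n' _ ->]; exists n'.
Qed.

(** The nodes of K and K' are both in bijection with the blobs, and their edges
    with the edges of T that are not inside a blob; the trees substituted at
    matching nodes are the same subtree of T by [etale_iso]. *)
Lemma blobs_hom (T K K' : otree) (a : node K -> otree) (a' : node K' -> otree)
    (a_nt : forall n, nontrivial (a n)) (a_nt' : forall n, nontrivial (a' n))
    (k : forall n, leaf (a n) -> input n) (k' : forall n, leaf (a' n) -> input n)
    (k_bij : forall n, bijective (@k n)) (k_bij' : forall n, bijective (@k' n))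
    (f : diso (subst a_nt k_bij) T) (f' : diso (subst a_nt' k_bij') T) :
  blobs f = blobs f' ->
  exists (u : diso K K') (v : forall n, diso (a n) (a' (fn u n)))
    (vk : forall n (l : leaf (a n)), k' _ (leaf_map (v n) l) = input_map u (k _ l)),
    diso_comp (subst_map a_nt a_nt' k_bij k_bij' vk) f' = f.
Proof.
move=> E; have E1 := blobs_sub E; have E2 := blobs_sub (esym E).
have M1 := blob_mark_sub E1; have M2 := blob_mark_sub E2.
have [c cB cE] := bij_over (blob_inj (f := f)) (blob_inj (f := f')) E1 E2.
have srcI (K0 : otree) a0 a_nt0 k0 k_bij0 (f0 : diso (@subst K0 a0 a_nt0 k0 k_bij0) T) :
    injective (fun m => blob_edge f0 (src m)).
  by move=> m m' /blob_edge_inj /src_inj.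
have [b bB bE] : {b : mark K -> mark K' | bijective b &
    forall m, blob_edge f' (src (b m)) = blob_edge f (src m)}.
  apply: (bij_over (srcI _ _ _ _ _ f) (srcI _ _ _ _ _ f')) => m.
    by have [m' ? _] := M1 m; exists m'.
  by have [m' ? _] := M2 m; exists m'.
have [d dB dE] : {d : edge K -> edge K' | bijective d &
    forall e, blob_edge f' (d e) = blob_edge f e}.
  apply: (bij_over (@blob_edge_inj _ _ _ _ _ _ f) (@blob_edge_inj _ _ _ _ _ _ f')) => e.
    case: (edge_case e) => [->|[m ->]]; last by exists (src (b m)).
    by exists (oroot K'); rewrite !blob_edge_root.
  case: (edge_case e) => [->|[m ->]]; last by have [m' ? _] := M2 m; exists (src m').
  by exists (oroot K); rewrite !blob_edge_root.
have H1 m : src (b m) = d (src m) by apply: (@blob_edge_inj _ _ _ _ _ _ f'); rewrite bE dE.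
have H2 m : par (b m) = c (par m).
  have [m' Em Ep] := M1 m; have -> : b m = m' by apply: (srcI _ _ _ _ _ f'); rewrite bE Em.
  by apply: (blob_inj (f := f')); rewrite Ep cE.
have H3 n : tgt (c n) = d (tgt n).
  apply: (@blob_edge_inj _ _ _ _ _ _ f'); rewrite dE -!blob_etale_root.
  exact/blob_eq_root/cE.
pose u := DIso dB bB cB H1 H2 H3.
pose V n := blob_eq_iso (esym (cE n)).
pose v n : diso (a n) (a' (fn u n)) := projT1 (V n).
have vE n e : ee (blob_etale f' (c n)) (fe (v n) e) = ee (blob_etale f n) e.
  exact: (projT2 (V n)).
have vk n (l : leaf (a n)) : k' _ (leaf_map (v n) l) = input_map u (k _ l).
  apply/val_inj/(srcI _ _ _ _ _ f').
  by rewrite /= bE -!blob_etale_leaf -vE.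
exists u, v, vk; apply: diso_eq_edge => -[e|[n i]] /=; first exact: dE.
have := vE n (val i).
have := subst_emb_inner k' (inner_map (v n) i).
by rewrite /= subst_emb_inner => ->.
Qed.

Lemma blobs_hom_eq (T K K' : otree) (a : node K -> otree) (a' : node K' -> otree)
    (a_nt : forall n, nontrivial (a n)) (a_nt' : forall n, nontrivial (a' n))
    (k : forall n, leaf (a n) -> input n) (k' : forall n, leaf (a' n) -> input n)
    (k_bij : forall n, bijective (@k n)) (k_bij' : forall n, bijective (@k' n))
    (f : diso (subst a_nt k_bij) T) (f' : diso (subst a_nt' k_bij') T)
    (u : diso K K') (v : forall n, diso (a n) (a' (fn u n)))
    (vk : forall n (l : leaf (a n)), k' _ (leaf_map (v n) l) = input_map u (k _ l)) :
  diso_comp (subst_map a_nt a_nt' k_bij k_bij' vk) f' = f -> blobs f = blobs f'.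
Proof.
move=> <-.
have E n : blob (diso_comp (subst_map a_nt a_nt' k_bij k_bij' vk) f') n = blob f' (fn u n).
  apply/setP => x; apply/imsetP/imsetP => -[y _ ->] /=.
    by exists (fn (v n) y).
  by have [g _ Kg] := fn_bij (v n); exists (g y) => //=; rewrite /subst_map_n /= Kg.
apply/setP => B; apply/imsetP/imsetP => -[n _ ->]; first by exists (fn u n).
by have [g _ Kg] := fn_bij u; exists (g n); rewrite // E Kg.
Qed.

(** The edges of K and the trees substituted into its nodes all embed in the
    composite. *)
Lemma subst_map_inj (K K' : otree) (a : node K -> otree) (a' : node K' -> otree)
    (a_nt : forall n, nontrivial (a n)) (a_nt' : forall n, nontrivial (a' n))
    (k : forall n, leaf (a n) -> input n) (k' : forall n, leaf (a' n) -> input n)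
    (k_bij : forall n, bijective (@k n)) (k_bij' : forall n, bijective (@k' n))
    (u u' : diso K K') (v : forall n, diso (a n) (a' (fn u n)))
    (v' : forall n, diso (a n) (a' (fn u' n)))
    (vk : forall n (l : leaf (a n)), k' _ (leaf_map (v n) l) = input_map u (k _ l))
    (vk' : forall n (l : leaf (a n)), k' _ (leaf_map (v' n) l) = input_map u' (k _ l)) :
  subst_map a_nt a_nt' k_bij k_bij' vk = subst_map a_nt a_nt' k_bij k_bij' vk' ->
  existT (fun u => forall n, diso (a n) (a' (fn u n))) u v = existT _ u' v'.
Proof.
move=> E; have Eu : u = u'.
  apply: diso_eq_edge => e.
  have := congr1 (fun g : diso (subst a_nt k_bij) (subst a_nt' k_bij') => fe g (inl e)) E.
  by case.
subst u'; congr existT; apply: functional_extensionality_dep => n.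
apply: diso_eq_edge => e; apply: (@ee_inj _ _ (subst_in a_nt' k_bij' (fn u n))).
have := congr1 (fun g : diso (subst a_nt k_bij) (subst a_nt' k_bij') =>
  fe g (subst_emb k e)) E.
by rewrite /= !(subst_map_emb a_nt a_nt').
Qed.

(** * Every partition into blobs comes from a substitution *)

Section Quotient.
Variables (T : otree) (P : {set {set node T}}).
Hypothesis hP : blob_partition P.

Definition block : finType := {B : {set node T} | B \in P}.

Lemma block_of_in x : pblock P x \in P.
Proof. by case/andP: hP => /and3P[/eqP c _ _] _; rewrite pblock_mem // c inE. Qed.

Definition block_of (x : node T) : block := Sub (pblock P x) (block_of_in x).

Lemma mem_block_of x : x \in val (block_of x).
Proof. by case/andP: hP => /and3P[/eqP c _ _] _; rewrite mem_pblock c inE. Qed.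

Lemma block_ofE (B : block) x : x \in val B -> block_of x = B.
Proof.
move=> xB; apply: val_inj; rewrite /=.
by case/andP: hP => /and3P[_ t _] _; rewrite (def_pblock t (valP B) xB).
Qed.

Lemma block_top (B : block) : {t | t \in val B &
  forall x, x \in val B -> x = t \/ exists2 y, y \in val B & child x y}.
Proof.
apply: cid2; apply/treelikeP.
by case/andP: hP => _ /forall_inP/(_ _ (valP B)).
Qed.

Definition top_node (B : block) : node T := s2val (block_top B).

Lemma top_node_in (B : block) : top_node B \in val B.
Proof. exact: (s2valP (block_top B)). Qed.

Lemma top_nodeP (B : block) x : x \in val B -> x = top_node B \/ exists2 y, y \in val B & child x y.
Proof. exact: (s2valP' (block_top B)). Qed.

Lemma block_of_top (B : block) : block_of (top_node B) = B.
Proof. exact/block_ofE/top_node_in. Qed.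

(** Otherwise each member of B would have its parent in B, and the walk from B to
    the root would never leave B. *)
Lemma top_nodeN (B : block) y : y \in val B -> ~ child (top_node B) y.
Proof.
move=> yB cy.
have up x : x \in val B -> exists2 z, z \in val B & child x z.
  by case/top_nodeP=> [->|//]; exists y.
suff H (e : edge T) : forall n, tgt n = e -> n \notin val B.
  by have /negP := H _ _ (erefl (tgt y)); apply.
elim/otree_ind: e => [|m IH] n E; apply/negP => /up[z zB c].
  by have /childP[] := c.
have zm : z = par m by apply: child_fun c (child_src E).
by have /negP := IH _ erefl; rewrite -zm.
Qed.

(** The edges that disappear in the quotient, being inside a block. *)
Definition contracted (e : edge T) : bool :=
  [exists m, exists n : node T, [&& src m == e, tgt n == e & block_of n == block_of (par m)]].

Lemma contractedP (m : mark T) :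
  reflect (exists2 n, tgt n = src m & block_of n = block_of (par m)) (contracted (src m)).
Proof.
apply: (iffP existsP) => [[m' /existsP[n /and3P[/eqP/src_inj -> /eqP E /eqP b]]]|[n E b]].
  by exists n.
by exists m; apply/existsP; exists n; rewrite E b !eqxx.
Qed.

Lemma root_contracted : ~~ contracted (oroot T).
Proof.
apply/existsP => -[m /existsP[n /and3P[/eqP E _ _]]].
by have := src_neq_root m; rewrite E eqxx.
Qed.

Lemma top_contracted (B : block) : ~~ contracted (tgt (top_node B)).
Proof.
case: (edge_case (tgt (top_node B))) => [->|[m E]]; first exact: root_contracted.
rewrite E; apply/contractedP => -[n]; rewrite -E => /tgt_inj ->.
rewrite block_of_top => b; apply: (@top_nodeN B (par m)); last exact: child_src.
by rewrite b; apply: mem_block_of.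
Qed.

Lemma top_or_contracted (n : node T) : contracted (tgt n) \/ n = top_node (block_of n).
Proof.
case: (top_nodeP (mem_block_of n)) => [|[y yB /existsP[m /andP[/eqP E /eqP p]]]].
  by right.
by left; rewrite -E; apply/contractedP; exists n => //; rewrite p (block_ofE yB).
Qed.

Definition quot_diag : diagram :=
  @Diagram {e : edge T | ~~ contracted e} {m : mark T | ~~ contracted (src m)} block
    (fun m => Sub (src (val m)) (valP m)) (fun m => block_of (par (val m)))
    (fun B => Sub (tgt (top_node B)) (top_contracted B)).

Definition quot_root : edge quot_diag := Sub (oroot T) root_contracted.

Lemma quot_tgt_inj : injective (@tgt quot_diag).
Proof.
by move=> B B' /(congr1 val) /= /tgt_inj E; rewrite -(block_of_top B) E block_of_top.
Qed.

Lemma quot_src_inj : injective (@src quot_diag).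
Proof. by move=> m m' /(congr1 val) /= /src_inj /val_inj. Qed.

Lemma quot_srcP (e : edge quot_diag) : (e \in codom (@src quot_diag)) = (e != quot_root).
Proof.
apply/codomP/idP => [[m ->]|/eqP ne].
  by rewrite -(inj_eq val_inj) /= src_neq_root.
case: (edge_case (val e)) => [E|[m E]]; first by case: ne; apply: val_inj.
have h : ~~ contracted (src m) by rewrite -E; apply: (valP e).
by exists (Sub m h); apply: val_inj.
Qed.

Lemma quot_walkP (e : edge quot_diag) : exists k, iter k (@walk quot_diag) e = quot_root.
Proof.
apply: walkI; first exact: quot_src_inj.
move=> Q Q0 QS.
(* A walk in T inside a block corresponds to no step in the quotient, so the
   induction along T also follows the output edges of the blocks met. *)
have H (f : edge T) : (forall h : ~~ contracted f, Q (Sub f h)) /\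
    forall n, tgt n = f -> Q (@tgt quot_diag (block_of n)).
  elim/otree_ind: f => [|m [_ /(_ _ erefl) IH]].
    have H0 h : Q (Sub (oroot T) h).
      by have -> : Sub (oroot T) h = quot_root by apply: val_inj.
    split=> // n E; case: (top_or_contracted n) => [|Et].
      by rewrite E (negPf root_contracted).
    have h : ~~ contracted (oroot T) by apply: root_contracted.
    suff -> : @tgt quot_diag (block_of n) = Sub (oroot T) h by apply: H0.
    by apply: val_inj; rewrite /= -Et.
  have H1 h : Q (Sub (src m) h).
    pose m' : mark quot_diag := Sub m h.
    have -> : Sub (src m) h = src m' by apply: val_inj.
    exact: QS.
  split=> // n E; case: (boolP (contracted (src m))) => [/contractedP[n' E']|h].
    by have -> : n = n' by [apply: (@tgt_inj T); rewrite E E']; move=> ->.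
  case: (top_or_contracted n) => [|Et]; first by rewrite E (negPf h).
  have -> : @tgt quot_diag (block_of n) = Sub (src m) h; last exact: H1.
  by apply: val_inj; rewrite /= -Et.
by case=> f h; apply: (H f).1.
Qed.

Definition quot : otree :=
  @OTree quot_diag quot_root quot_tgt_inj quot_src_inj quot_srcP quot_walkP.

Section BlockTree.
Variable B : node quot.

Lemma block_up (n : node T) : n \in val B ->
  tgt n = tgt (top_node B) \/ exists2 m, src m = tgt n & par m \in val B.
Proof.
case/top_nodeP=> [->|[y yB /existsP[m /andP[/eqP E /eqP p]]]]; first by left.
by right; exists m; rewrite // p.
Qed.

Lemma block_root (m : mark T) : par m \in val B -> src m <> tgt (top_node B).
Proof. by move=> mB E; apply: (top_nodeN mB); apply: child_src. Qed.

Definition block_tree : otree := @subt T (fun n => n \in val B) _ block_up block_root.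

Definition block_etale : etale block_tree T := subt_etale block_up block_root.

Lemma block_nontrivial : nontrivial block_tree.
Proof. by apply/card_gt0P; exists (Sub (top_node B) (top_node_in B)). Qed.

Lemma block_leafP (l : leaf block_tree) :
  exists i : input B, val (src (val i)) = val (val l).
Proof.
have nt n : n \in val B -> tgt n <> val (val l).
  move=> nB E; case/negP: (valP l); apply/codomP.
  by exists (Sub n nB); apply/esym/val_inj.
have /sub_edgeP[E|[m E mB]] := valP (val l).
  by case: (nt _ (top_node_in B) (esym E)).
have h : ~~ contracted (src m).
  apply/contractedP => -[n En]; rewrite (block_ofE mB) => Bn; apply: (nt n _ (etrans En E)).
  by rewrite -Bn mem_block_of.
have p : par (Sub m h : mark quot) == B by apply/eqP/block_ofE.
by exists (Sub (Sub m h : mark quot) p).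
Qed.

Definition block_input (l : leaf block_tree) : input B := projT1 (cid (block_leafP l)).

Lemma block_inputE (l : leaf block_tree) : val (src (val (block_input l))) = val (val l).
Proof. by rewrite /block_input; case: cid. Qed.

Lemma block_input_bij : bijective block_input.
Proof.
apply: inj_surj_bij => [l l' E|i].
  by do 2!apply: val_inj; rewrite -!block_inputE E.
pose m := val (val i).
have Em : block_of (par m) = B by apply/eqP/(valP i).
have mB : par m \in val B by rewrite -Em mem_block_of.
pose e : edge block_tree := src (Sub m mB : mark block_tree).
have h : e \notin codom (@tgt block_tree).
  apply/codomP => -[n /(congr1 val) /= E]; have /contractedP[] := valP (val i).
  by exists (val n) => //; rewrite Em; apply/block_ofE/(valP n).
exists (Sub e h); do 2!apply: val_inj; apply: (@src_inj T).
exact: (block_inputE (Sub e h)).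
Qed.

End BlockTree.

Lemma blobs_exists : exists f : diso (subst block_nontrivial block_input_bij) T,
  blobs f = P.
Proof.
have kE n (l : leaf (block_tree n)) :
    ee (block_etale n) (val l) = val (src (val (block_input l))).
  by rewrite block_inputE.
have [|f fE fN] := @subst_glue_iso quot block_tree block_nontrivial block_input
  block_input_bij T (fun e => val e) block_etale (fun=> erefl) kE erefl.
  by move=> x; exists (block_of x), (Sub x (mem_block_of x)).
exists f.
have E (B : block) : blob f B = val B.
  apply/setP => x; apply/imsetP/idP => [[y _ ->]|xB] /=.
    by rewrite fN; apply: (valP y).
  by exists (Sub x xB); rewrite //= fN.
apply/setP => C; apply/imsetP/idP => [[B _ ->]|CP]; first by rewrite E; apply: (valP B).
by exists (Sub C CP : block); rewrite // E.
Qed.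

End Quotient.

(** * Distances in rooted trees *)

Section Dist.
Variable R : rtree.
Implicit Types (x y : vtx R) (p : seq (vtx R)).

Let reach x y n := [exists p : n.-tuple (vtx R), path (@adj R) x p && (last x p == y)].

Lemma dist_le x p : path (@adj R) x p -> (dist x (last x p) <= size p)%N.
Proof.
move=> hp; rewrite leqNgt; apply/negP => lt.
have ltN : (size p < #|vtx R|)%N.
  by apply: leq_trans lt _; rewrite -[X in (_ <= X)%N](size_iota 0); apply: find_size.
have := before_find 0%N lt; rewrite nth_iota // add0n => /existsP[].
by exists (in_tuple p); rewrite /= hp eqxx.
Qed.

Lemma dist_path x y : exists2 p, path (@adj R) x p & last x p = y /\ size p = dist x y.
Proof.
have /connectP[q hq ->] := adj_conn x y.
case/shortenP: hq => p hp up _.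
have ltN : (size p < #|vtx R|)%N.
  by rewrite -[X in (X <= _)%N]/(size (x :: p)) -(card_uniqP up) max_card.
have : has (reach x (last x p)) (iota 0 #|vtx R|).
  apply/hasP; exists (size p); first by rewrite mem_iota.
  by apply/existsP; exists (in_tuple p); rewrite /= hp eqxx.
move=> h; have := nth_find 0%N h; rewrite has_find size_iota in h.
rewrite nth_iota // add0n => /existsP[t /andP[ht /eqP Et]].
by exists t => //; rewrite size_tuple.
Qed.

Lemma top_vertexE (B : {set vtx R}) (hB : is_subtree B) t :
  t \in B -> (forall x, x \in B -> x <> t -> (dist (rroot R) t < dist (rroot R) x)%N) ->
  top_vertex hB = t.
Proof.
move=> tB H; rewrite /top_vertex; case: arg_minnP; first exact: (xchooseP (subtree_ex hB)).
move=> x xB /(_ t tB) le; case: (eqVneq x t) => // /eqP/(H _ xB).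
by rewrite ltnNge le.
Qed.

End Dist.

Lemma within_sym (R : rtree) (B : {set vtx R}) : symmetric (within B).
Proof.
suff H x y : within B x y -> within B y x by move=> x y; apply/idP/idP; apply: H.
by case/and3P=> xB yB a; apply/and3P; split=> //; rewrite adj_sym.
Qed.

Lemma connect_within_sym (R : rtree) (B : {set vtx R}) x y :
  connect (within B) x y = connect (within B) y x.
Proof. exact: sym_connect_sym (@within_sym R B) x y. Qed.

Lemma core_gen_nt (T : otree) (h : nontrivial T) : core_gen T = gen (rclass (core h)).
Proof.
rewrite /core_gen; case: bool_case => h'; last by case/negP: (h').
by rewrite (bool_irrelevance h' h).
Qed.

Lemma core_gen_triv (T : otree) : ~~ nontrivial T -> core_gen T = 1.
Proof.
move=> hN; rewrite /core_gen; case: bool_case => [h|_]; last by [].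
by case/negP: hN; exact: h.
Qed.

Lemma subtree_gen_nt (R : rtree) (B : {set vtx R}) (h : is_subtree B) :
  subtree_gen B = gen (rclass (subtree h)).
Proof.
rewrite /subtree_gen; case: bool_case => h'; last by case/negP: (h').
by rewrite (bool_irrelevance h' h).
Qed.

Lemma subtree_gen0 (R : rtree) : subtree_gen (set0 : {set vtx R}) = 1.
Proof.
have h0 : ~~ is_subtree (set0 : {set vtx R}) by rewrite /is_subtree eqxx.
rewrite /subtree_gen; case: bool_case => [h|_]; last by [].
by case/negP: h0; exact: h.
Qed.

(** * A rooted tree identified with a core *)

(** Taking th for an isomorphism onto a rooted tree R, instead of R for the core
    itself, covers all representatives of the isomorphism class of the core. *)
Section CoreIso.
Variables (T : otree) (hT : nontrivial T) (R : rtree) (th : node T -> vtx R).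
Hypothesis th_bij : bijective th.
Hypothesis th_adj : forall x y, adj (th x) (th y) = child x y || child y x.
Hypothesis th_root : th (rootnode hT) = rroot R.

Let thI : injective th := bij_inj th_bij.

Lemma th_surj v : exists x, v = th x.
Proof. by have [g _ K] := th_bij; exists (g v). Qed.

Lemma mem_th (B : {set node T}) x : (th x \in th @: B) = (x \in B).
Proof. exact/mem_imset/thI. Qed.

(** The walk to the root is a path of length the depth, and a step along an edge
    changes the depth by one. *)
Lemma dist_depth x : dist (rroot R) (th x) = depth (tgt x).
Proof.
apply/eqP; rewrite eqn_leq; apply/andP; split.
  suff H (e : edge T) : forall x, tgt x = e ->
      exists2 p, path (@adj R) (rroot R) p & last (rroot R) p = th x /\ size p = depth e.
    by have [p hp [<- <-]] := H _ x erefl; apply: dist_le.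
  elim/otree_ind: e => [{}x E|m IH {}x E].
    exists [::] => //=; rewrite depth_root -th_root; split=> //; congr th.
    by apply: (@tgt_inj T); rewrite tgt_rootnode.
  have [p hp [Ep Es]] := IH _ erefl; exists (rcons p (th x)).
    by rewrite rcons_path hp Ep th_adj child_src ?orbT.
  by rewrite last_rcons size_rcons Es depth_src.
have [p hp [Ep <-]] := dist_path (rroot R) (th x).
have -> : size p = (depth (tgt (rootnode hT)) + size p)%N by rewrite tgt_rootnode depth_root.
rewrite -th_root in hp Ep; elim: p (rootnode hT) hp Ep => [|v p IH] y /=.
  by move=> _ /thI ->; rewrite addn0.
have [z ->] := th_surj v; rewrite th_adj => /andP[c hp] /(IH _ hp).
move/leq_trans; apply; rewrite addnS -addSn leq_add2r.
by case/orP: c => /child_depth -> //; rewrite leqW // leqnSn.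
Qed.

Section Embedded.
Variables (A : otree) (j : etale A T).

Definition node_image : {set vtx R} := th @: [set en j n | n : node A].

Lemma mem_node_image n : th (en j n) \in node_image.
Proof. by rewrite mem_th; apply: imset_f. Qed.

Lemma node_imageP v : v \in node_image -> exists n, v = th (en j n).
Proof. by case/imsetP=> _ /imsetP[n _ ->] ->; exists n. Qed.

Lemma connect_node_image (P : {set vtx R}) (x y : node A) :
  nontrivial A -> node_image \subset P ->
  connect (within P) (th (en j x)) (th (en j y)).
Proof.
move=> hA /subsetP sP.
apply: (connect_ind (P := fun y => connect (within P) (th (en j x)) (th (en j y))))
  (core_conn (T_nt := hA) x y) => // {}y z IH c.
apply: connect_trans IH (connect1 _).
by rewrite /within !sP ?mem_node_image //= th_adj !en_child.
Qed.

Lemma node_image_subtree : nontrivial A -> is_subtree node_image.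
Proof.
move=> hA; apply/andP; split.
  by apply/set0Pn; exists (th (en j (rootnode hA))); apply: mem_node_image.
apply/forall_inP => _ /node_imageP[x ->]; apply/forall_inP => _ /node_imageP[y ->].
exact: connect_node_image.
Qed.

(** The roots agree because the root node of A is the node of least depth, and
    the depth is the distance that singles out the top vertex. *)
Lemma node_image_riso (hA : nontrivial A) (h : is_subtree node_image) : riso (core hA) (subtree h).
Proof.
exists (fun n : vtx (core hA) => Sub (th (en j n)) (mem_node_image n)); split.
- apply: inj_surj_bij => [n n' /(congr1 val) /= /thI /en_inj //|v].
  by have [n E] := node_imageP (valP v); exists n; apply: val_inj.
- by move=> x y; rewrite /= th_adj !en_child.
apply: val_inj; apply/esym; rewrite /=.
apply: top_vertexE => [|_ /node_imageP[x ->] ne]; first exact: mem_node_image.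
rewrite !dist_depth !en_tgt; rewrite -/(rootnode hA) tgt_rootnode.
case: (ee_above j (tgt x)) => // E; case: ne.
by rewrite -(@tgt_inj A (rootnode hA) x) // tgt_rootnode.
Qed.

Lemma subtree_gen_image : subtree_gen node_image = core_gen A.
Proof.
case: (boolP (nontrivial A)) => h.
  rewrite (core_gen_nt h) (subtree_gen_nt (node_image_subtree h)).
  congr gen; apply/rclassP/riso_sym/node_image_riso.
rewrite (core_gen_triv h) -(subtree_gen0 R); congr subtree_gen.
apply/setP => v; rewrite inE; apply/negP => /node_imageP[n _].
by case/negP: h; apply/card_gt0P; exists n.
Qed.

End Embedded.

(** In a connected set take a member t without parent in the set.  Along a path
    starting at t, each vertex is linked to t by a chain of parents in the set: a
    step to a child lengthens the chain, and a step to the parent shortens it. *)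
Lemma treelike_subtree (B : {set node T}) : is_subtree (th @: B) = treelike B.
Proof.
apply/idP/treelikeP => [/andP[B0 /forall_inP cB]|[t tB H]]; last first.
  apply/andP; split; first by apply/set0Pn; exists (th t); rewrite mem_th.
  have up x : x \in B -> connect (within (th @: B)) (th x) (th t).
    suff G (e : edge T) : forall x, tgt x = e -> x \in B ->
        connect (within (th @: B)) (th x) (th t) by apply: (G (tgt x)).
    elim/otree_ind: e => [|m IH] {}x E xB; case: (H x xB) => [-> //|[y yB c]].
      by have /childP[] := c.
    have Ey : y = par m by apply: child_fun c (child_src E).
    apply: connect_trans (IH y _ yB); last by rewrite Ey.
    by apply: connect1; rewrite /within !mem_th xB yB th_adj c.
  apply/forall_inP => _ /imsetP[x xB ->]; apply/forall_inP => _ /imsetP[y yB ->].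
  by apply: connect_trans (up x xB) _; rewrite connect_within_sym; apply: up.
have [t tB tN] : exists2 t, t \in B & forall y, y \in B -> ~ child t y.
  have /set0Pn[_ /imsetP[x xB _]] := B0.
  suff G (e : edge T) : forall x, tgt x = e -> x \in B ->
      exists2 t, t \in B & forall y, y \in B -> ~ child t y by apply: (G (tgt x)).
  elim/otree_ind: e => [|m IH] {xB}x E xB.
    by exists x => // y _ /childP[].
  case: (boolP (par m \in B)) => mB; first exact: IH mB.
  exists x => // y yB c; case/negP: mB.
  by rewrite -(child_fun c (child_src E)).
exists t => // x xB.
pose up (x y : node T) := child x y && (y \in B).
suff : connect up x t.
  case/connectP=> -[|y p] /=; first by move=> _ ->; left.
  by case/andP=> /andP[c yB] _ _; right; exists y.
have := forall_inP (cB (th t) _) (th x); rewrite !mem_th => /(_ tB xB) C.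
suff [y [/thI -> _ //]] : exists y, [/\ th x = th y, y \in B & connect up y t].
apply: (connect_ind (P := fun v => exists y, [/\ v = th y, y \in B & connect up y t])) C.
  by exists t.
move=> _ v [y [-> yB cy]] /and3P[_ + +]; have [z ->] := th_surj v.
rewrite mem_th th_adj => zB c; exists z; split=> //; case/orP: c => c; last first.
  by apply: connect_trans cy; apply: connect1; rewrite /up c.
case/connectP: cy => -[|w p] /=; first by move=> _ E; case: (tN z zB); rewrite E.
case/andP=> /andP[c' _] hp E; apply/connectP; exists p; rewrite (child_fun c c') //.
Qed.

(** In a closed nonempty set every member is linked to the root by its ancestors;
    conversely, in a connected set the only member without parent in the set is
    the root of T as soon as the latter belongs to it. *)
Lemma admissible_root_closed (S : {set node T}) : admissible (th @: S) = root_closed S.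
Proof.
have top_root x : tgt x = oroot T -> x = rootnode hT.
  by move=> E; apply: (@tgt_inj T); rewrite tgt_rootnode.
apply/orP/root_closedP => [[|]|cl].
- by rewrite imset_eq0 => /eqP -> x y; rewrite inE.
- rewrite -th_root mem_th => /andP[rS cS].
  have : is_subtree (th @: S).
    by rewrite /is_subtree cS andbT; apply/set0Pn; exists (th (rootnode hT)); rewrite mem_th.
  rewrite treelike_subtree => /treelikeP[t tS H] x y xS c.
  case: (H x xS) => [Ex|[z zS c']]; last by rewrite (child_fun c c').
  case: (H _ rS) => [Er|[z _ /childP[]]]; last by rewrite tgt_rootnode.
  by have /childP[] := c; rewrite Ex -Er tgt_rootnode.
case: (eqVneq S set0) => [->|/set0Pn[x xS]]; [by left; rewrite imset0 | right].
have rS : rootnode hT \in S.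
  suff G (e : edge T) : forall x, tgt x = e -> x \in S -> rootnode hT \in S by apply: (G (tgt x)).
  elim/otree_ind: e => [|m IH] {xS}x E xS; first by rewrite -(top_root x).
  by apply: (IH (par m) erefl); apply: cl xS (child_src E).
suff /andP[_ ->] : is_subtree (th @: S) by rewrite andbT -th_root mem_th.
rewrite treelike_subtree; apply/treelikeP; exists (rootnode hT) => // y yS.
case: (edge_case (tgt y)) => [/top_root|[m E]]; [by left | right].
by exists (par m); [apply: cl yS (child_src E) | apply: child_src].
Qed.

Lemma tree_partition_blob (P : {set {set node T}}) :
  tree_partition ((fun B : {set node T} => th @: B) @: P) = blob_partition P.
Proof.
have imT : th @: [set: node T] = [set: vtx R].
  by apply/setP => v; have [x ->] := th_surj v; rewrite mem_th !inE.
rewrite /tree_partition /blob_partition -imT imset_partition; last exact: thI.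
case: (boolP (partition _ _)) => //= hP; apply/forall_inP/forall_inP => H B.
  move=> BP; rewrite -treelike_subtree /is_subtree H ?imset_f // andbT imset_eq0.
  exact: partition_neq0 hP BP.
by case/imsetP=> C /H; rewrite -treelike_subtree => /andP[_ h] ->.
Qed.
End CoreIso.

(** * Cuts and blobs in the core *)

Lemma node_image_sub (T : otree) (R : rtree) (th : node T -> vtx R) (A : otree) (j : etale A T)
    (P : {set vtx R}) : (forall n, th (en j n) \in P) -> node_image th j \subset P.
Proof. by move=> H; apply/subsetP => v /node_imageP[n ->]. Qed.

Section CoreDecomposition.
Variables (T : otree) (hT : nontrivial T) (R : rtree) (th : node T -> vtx R).
Hypothesis th_bij : bijective th.
Hypothesis th_adj : forall x y, adj (th x) (th y) = child x y || child y x.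
Hypothesis th_root : th (rootnode hT) = rroot R.

Let thI : injective th := bij_inj th_bij.

Section Cuts.
Variables (b : otree) (a : leaf b -> otree) (f : diso (graft a) T).

Lemma cut_top_child l l' x y :
  child (en (cut_top f l) x) (en (cut_top f l') y) -> l = l'.
Proof.
case/existsP=> m /andP[/eqP E /eqP /em_surj[m' _ Em]].
by move: E; rewrite -Em em_src en_tgt => /esym/cut_top_disj.
Qed.

Lemma cut_top_component l n (S := ~: (th @: cut f)) :
  [set y in S | connect (within S) (th (en (cut_top f l) n)) y] = node_image th (cut_top f l).
Proof.
have sS : node_image th (cut_top f l) \subset S.
  by apply: node_image_sub => n'; rewrite inE (mem_th th_bij) cut_topN.
apply/setP => v; rewrite inE; apply/andP/idP => [[_]|/[dup] vs /node_imageP[n' ->]]; last first.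
  split; first by apply: (subsetP sS); apply: mem_node_image.
  by apply: (connect_node_image th_bij th_adj _ _ _ sS); apply/card_gt0P; exists n.
apply: (connect_ind (P := fun v => v \in node_image th (cut_top f l))).
  exact: mem_node_image.
move=> _ w /node_imageP[n' ->] /and3P[_ + +]; have [z ->] := th_surj th_bij w.
rewrite inE (mem_th th_bij) th_adj => /cut_topP[l' [n2 ->]] c.
suff -> : l = l' by apply: mem_node_image.
by case/orP: c => /cut_top_child.
Qed.

(** The tree above a leaf is connected, and no edge of T joins two such trees,
    since it would have to be an edge of both.  Trees without nodes have an empty
    image and give no component. *)
Lemma components_cut :
  components (~: (th @: cut f)) =
  [set node_image th (cut_top f l) | l in [pred l | nontrivial (a l)]].
Proof.
apply/setP => C; apply/imsetP/imsetP => [[v vS ->]|[l /card_gt0P[n _] ->]].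
  have [z Ez] := th_surj th_bij v; move: vS; rewrite Ez inE (mem_th th_bij).
  case/cut_topP=> l [n En]; exists l; first by apply/card_gt0P; exists n.
  by rewrite En; apply: cut_top_component.
exists (th (en (cut_top f l) n)); last exact/esym/cut_top_component.
by rewrite inE (mem_th th_bij) cut_topN.
Qed.

Lemma prod_components (A : comAlgType rat) (F : Sym RTrees -> A) : F 1 = 1 ->
  \prod_(C in components (~: (th @: cut f))) F (subtree_gen C) =
  \prod_(l : leaf b) F (core_gen (a l)).
Proof.
move=> F1; rewrite components_cut big_imset /=; last first.
  move=> l l' /card_gt0P[n _] _ E.
  have : th (en (cut_top f l) n) \in node_image th (cut_top f l) by apply: mem_node_image.
  rewrite E => /node_imageP[n' /thI /(congr1 (@tgt T))].
  by rewrite !en_tgt => /cut_top_disj.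
rewrite big_mkcond /=; apply: eq_bigr => l _.
rewrite inE (subtree_gen_image th_bij th_adj th_root); case: ifP => // /negbT h.
by rewrite (core_gen_triv h) F1.
Qed.

Lemma subtree_gen_cut : subtree_gen (th @: cut f) = core_gen b.
Proof. exact: (subtree_gen_image th_bij th_adj th_root (cut_bot f)). Qed.

End Cuts.

Section Blobs.
Variables (K : otree) (a : node K -> otree).
Variable a_nt : forall n, nontrivial (a n).
Variable k : forall n, leaf (a n) -> input n.
Variable k_bij : forall n, bijective (@k n).
Variable f : diso (subst a_nt k_bij) T.

(** An edge of T from the blob of n down to that of n' is at once the root edge of
    the tree substituted at n and a leaf of the one at n', as the inner edges of
    these trees stay in their blobs; hence it is an edge of K. *)
Lemma blob_child n n' : n != n' ->
  child n n' = [exists x in blob f n, exists y in blob f n', child x y].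
Proof.
move=> ne; apply/existsP/exists_inP => [[m /andP[/eqP E /eqP <-]]|[_ /imsetP[x _ ->]]].
  have [x [l [Ex El]]] := subst_src_leaf a_nt k_bij m.
  exists (en (blob_etale f n) (rootnode (a_nt n))); first exact: mem_blob.
  apply/exists_inP; exists (en (blob_etale f (par m)) (par x)); first exact: mem_blob.
  rewrite -em_par child_src // em_src en_tgt tgt_rootnode Ex.
  by rewrite blob_etale_root blob_etale_leaf El E.
case/exists_inP=> _ /imsetP[y _ ->] /existsP[m /andP[/eqP E /eqP /em_surj[m' _ Em]]].
move: E; rewrite -Em em_src en_tgt.
case: (subst_case (src m')) => [E|[l ->]|[i ->]]; first by case/eqP: (src_neq_root m').
  rewrite blob_etale_leaf; case: (subst_case (tgt x)) => [->|[l' /leaf_neq_tgt //]|[i ->]].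
    rewrite blob_etale_root => /blob_edge_inj E; exists (val (k l)).
    by rewrite E eqxx (valP (k l)).
  by rewrite /= subst_emb_inner => /(bij_inj (fe_bij f)).
case: (subst_case (tgt x)) => [->|[l' /leaf_neq_tgt //]|[i' ->]].
  by rewrite blob_etale_root /= subst_emb_inner => /(bij_inj (fe_bij f)).
rewrite /= !subst_emb_inner => /(bij_inj (fe_bij f)) H.
by have /(congr1 tag) /= En := Defs.inr_inj H; rewrite En eqxx in ne.
Qed.

Definition core_blobs : {set {set vtx R}} := (fun B : {set node T} => th @: B) @: blobs f.

Lemma core_blobs_partition : tree_partition core_blobs.
Proof. by rewrite (tree_partition_blob th_bij th_adj) blobs_partition. Qed.

Lemma core_blob_in n : th @: blob f n \in core_blobs.
Proof. by apply: imset_f; apply: imset_f. Qed.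

Lemma blob_rootnode (hK : nontrivial K) : rootnode hT \in blob f (rootnode hK).
Proof.
apply/imsetP; exists (rootnode (a_nt (rootnode hK))) => //; apply: (@tgt_inj T).
by rewrite en_tgt !tgt_rootnode blob_etale_root tgt_rootnode blob_edge_root.
Qed.

Lemma contract_riso (hK : nontrivial K) : riso (core hK) (contract core_blobs_partition).
Proof.
have adjE n n' : [exists x in th @: blob f n, exists y in th @: blob f n', adj x y] =
    [exists x in blob f n, exists y in blob f n', child x y || child y x].
  apply/exists_inP/exists_inP => -[x xB /exists_inP[y yB c]].
    case/imsetP: xB c => x0 x0B ->; case/imsetP: yB => y0 y0B ->; rewrite th_adj => c.
    by exists x0 => //; apply/exists_inP; exists y0.
  exists (th x); first by rewrite (mem_th th_bij).
  by apply/exists_inP; exists (th y); rewrite ?(mem_th th_bij) ?th_adj.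
exists (fun n : vtx (core hK) => Sub (th @: blob f n) (core_blob_in n)); split.
- apply: inj_surj_bij => [n n' /(congr1 val) /= /(imset_inj thI) /blob_inj //|C].
  have /imsetP[_ /imsetP[n _ ->] E] := valP C.
  by exists n; apply: val_inj.
- move=> n n'; rewrite /= adjE; case: (eqVneq n n') => [<-|ne].
    by rewrite eqxx /=; apply/esym/(@core_irr _ hK n).
  have -> /= : Sub (th @: blob f n) (core_blob_in n) !=
      Sub (th @: blob f n') (core_blob_in n') :> vtx (contract core_blobs_partition).
    by apply: contraNneq ne => /(congr1 val) /= /(imset_inj thI) /blob_inj ->.
  rewrite blob_child // [child n' n]blob_child 1?eq_sym //.
  apply/exists_inP/orP => [[x xB /exists_inP[y yB /orP[c|c]]]|].
  + by left; apply/exists_inP; exists x => //; apply/exists_inP; exists y.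
  + by right; apply/exists_inP; exists y => //; apply/exists_inP; exists x.
  case=> /exists_inP[x xB /exists_inP[y yB c]].
    by exists x => //; apply/exists_inP; exists y; rewrite ?c.
  by exists y => //; apply/exists_inP; exists x; rewrite ?c ?orbT.
apply: val_inj => /=; apply/esym/def_pblock.
- by case/andP: core_blobs_partition => /and3P[].
- exact: core_blob_in.
by rewrite -th_root (mem_th th_bij) blob_rootnode.
Qed.

Lemma prod_blobs (A : comAlgType rat) (F : Sym RTrees -> A) :
  \prod_(B in core_blobs) F (subtree_gen B) = \prod_(n : node K) F (core_gen (a n)).
Proof.
rewrite big_imset /=; last by move=> B B' _ _ /(imset_inj thI).
rewrite big_imset /=; last by move=> n n' _ _ /blob_inj.
apply: eq_bigr => n _; congr F.
exact: (subtree_gen_image th_bij th_adj th_root (blob_etale f n)).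
Qed.

End Blobs.
End CoreDecomposition.

(** * Fibres of the composition *)

Lemma twolevel_hom_eq (R : opaction) (x y : twolevel R) (u v : twolevel_hom x y) :
  existT (fun h : Defs.hom (bot x) (bot y) => forall i, Defs.hom (top i) (@top _ y (arity_map h i)))
    (hbot u) (@htop _ _ _ u) = existT _ (hbot v) (@htop _ _ _ v) -> u = v.
Proof.
case: u v => [b t g] [b' t' g'] /= E.
have Eb : b = b' by exact: (projT1_eq E).
subst b'; have := projT2_eq E; rewrite (Prop_irrelevance (projT1_eq E) erefl) /= => Et.
by subst t'; congr TwoLevelHom; apply: Prop_irrelevance.
Qed.

Lemma diso_comp_injl (D E F : diagram) (g g' : diso D E) (f : diso E F) :
  diso_comp g f = diso_comp g' f -> g = g'.
Proof.
move=> H; apply: diso_eq => x.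
- by apply: (bij_inj (fe_bij f)); have := congr1 (fun h => fe h x) H.
- by apply: (bij_inj (fm_bij f)); have := congr1 (fun h => fm h x) H.
by apply: (bij_inj (fn_bij f)); have := congr1 (fun h => fn h x) H.
Qed.

Definition fibre_cut (T : otree) (x : @fibre free_operad T) : {set node T} :=
  @cut T (bot (fpt x)) (@top free_operad (fpt x)) (Defs.fpath x).

Lemma fibre_cut_hom (T : otree) (x y : @fibre free_operad T) :
  inhabited (fibre_hom x y) <-> fibre_cut x = fibre_cut y.
Proof.
split=> [[[u E]]|E]; first exact: (cut_hom_eq E).
have [u [v uv]] := cut_hom E.
exact: (inhabits (exist _ (@TwoLevelHom free_operad (fpt x) (fpt y) u v (fun=> erefl)) uv)).
Qed.

Lemma fibre_cut_surj (T : otree) (S : {set node T}) :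
  root_closed S -> exists x : @fibre free_operad T, fibre_cut x = S.
Proof.
move=> /cut_exists[b [a [f <-]]].
by exists (@Fibre free_operad T (@TwoLevel free_operad b a (fun=> tt)) f).
Qed.

Lemma free_fibre_rigid (T : otree) (x y : @fibre free_operad T) (u v : fibre_hom x y) :
  u = v.
Proof.
case: u v => [u Eu] [v Ev]; apply: sval_inj => /=.
apply: twolevel_hom_eq; apply: graft_map_inj.
exact: diso_comp_injl (etrans Eu (esym Ev)).
Qed.

Definition fibre_blobs (T : otree) (x : @fibre bd_action T) : {set {set node T}} :=
  @blobs T (bot (fpt x)) (fun n => sval (@top bd_action (fpt x) n))
    (fun n => svalP (@top bd_action (fpt x) n))
    (fun n => sval (@glue bd_action (fpt x) n))
    (fun n => svalP (@glue bd_action (fpt x) n)) (Defs.fpath x).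

Lemma bd_square_conv (K K' : otree) (a : node K -> NTrees) (a' : node K' -> NTrees)
    (k : forall n, @Defs.hom corollas (leaf (sval (a n))) (input n))
    (k' : forall n, @Defs.hom corollas (leaf (sval (a' n))) (input n))
    (u : diso K K') (v : forall n, diso (sval (a n)) (sval (a' (fn u n)))) :
  (forall n (l : leaf (sval (a n))),
    sval (k' (fn u n)) (leaf_map (v n) l) = input_map u (sval (k n) l)) ->
  forall n, cmp (leaf_iso (v n)) (k' (fn u n)) = cmp (k n) (input_iso u n).
Proof. by move=> E n; apply: sval_inj; apply/funext => l; apply: E. Qed.

Lemma fibre_blobs_hom (T : otree) (x y : @fibre bd_action T) :
  inhabited (fibre_hom x y) <-> fibre_blobs x = fibre_blobs y.
Proof.
split=> [[[u E]]|E]; first exact: (blobs_hom_eq E).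
have [u [v [vk uv]]] := blobs_hom E.
have sq := bd_square_conv vk.
apply: (inhabits (exist _ (@TwoLevelHom bd_action (fpt x) (fpt y) u v sq) _)).
by rewrite -[RHS]uv; apply: diso_eq.
Qed.

Lemma fibre_blobs_surj (T : otree) (P : {set {set node T}}) :
  blob_partition P -> exists x : @fibre bd_action T, fibre_blobs x = P.
Proof.
move=> hP; have [f <-] := blobs_exists hP.
pose a (B : node (quot hP)) : NTrees := exist _ (block_tree B) (block_nontrivial B).
pose k (B : node (quot hP)) : @Defs.hom corollas (leaf (sval (a B))) (input B) :=
  exist _ (@block_input _ _ hP B) (block_input_bij B).
by exists (@Fibre bd_action T (@TwoLevel bd_action (quot hP) a k) f).
Qed.

Lemma bd_action_fibre_rigid (T : otree) (x y : @fibre bd_action T) (u v : fibre_hom x y) :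
  u = v.
Proof.
case: u v => [u Eu] [v Ev]; apply: sval_inj => /=.
apply: twolevel_hom_eq.
exact: (subst_map_inj (diso_comp_injl (etrans Eu (esym Ev)))).
Qed.

(** The operad and its action decompose a nontrivial T in the same way, since the
    outer tree of such a decomposition is nontrivial too; so it is enough to
    classify the decompositions for the action. *)
Definition to_action (T : NTrees) (x : @fibre bd_operad T) : @fibre bd_action (sval T) :=
  @Fibre bd_action (sval T)
    (@TwoLevel bd_action (sval (bot (fpt x))) (@top bd_operad (fpt x))
       (@glue bd_operad (fpt x))) (Defs.fpath x).

Lemma to_action_hom (T : NTrees) (x y : @fibre bd_operad T) :
  inhabited (fibre_hom x y) <-> inhabited (fibre_hom (to_action x) (to_action y)).
Proof.
split=> -[[[b t g] E]].
  exact: (inhabits (exist _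
    (@TwoLevelHom bd_action (fpt (to_action x)) (fpt (to_action y)) b t g) E)).
exact: (inhabits (exist _ (@TwoLevelHom bd_operad (fpt x) (fpt y) b t g) E)).
Qed.

Lemma to_action_surj (T : NTrees) (y : @fibre bd_action (sval T)) :
  exists x : @fibre bd_operad T, to_action x = y.
Proof.
case: y => -[K a k] f.
have hK : nontrivial K.
  have [g _ _] := fn_bij f; have /card_gt0P[x _] := svalP T.
  by apply/card_gt0P; exists (tag (g x)).
by exists (@Fibre bd_operad T (@TwoLevel bd_operad (exist _ K hK) a k) f).
Qed.

Lemma bd_operad_fibre_rigid (T : NTrees) (x y : @fibre bd_operad T) (u v : fibre_hom x y) :
  u = v.
Proof.
case: u v => [u Eu] [v Ev]; apply: sval_inj => /=.
apply: twolevel_hom_eq.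
exact: (subst_map_inj (diso_comp_injl (etrans Eu (esym Ev)))).
Qed.

(** * Incidence comultiplications on cores *)

Lemma diso_nontrivial (T T' : otree) : diso T T' -> nontrivial T = nontrivial T'.
Proof. by move=> f; rewrite /nontrivial (bij_eq_card (fn_bij f)). Qed.

Lemma core_gen_iso (T T' : otree) : diso T T' -> core_gen T = core_gen T'.
Proof.
move=> f; case: (boolP (nontrivial T)) => h; last first.
  by rewrite !core_gen_triv // -(diso_nontrivial f).
have h' : nontrivial T' by rewrite -(diso_nontrivial f).
rewrite (core_gen_nt h) (core_gen_nt h'); congr gen; apply/rclassP.
exists (fn f : vtx (core h) -> vtx (core h')); split.
- exact: fn_bij.
- by move=> x y; rewrite /= !(en_child (etale_diso f)).
apply: (@tgt_inj T'); rewrite /= ftgt -/(rootnode h) -/(rootnode h') !tgt_rootnode.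
exact: diso_root.
Qed.

Lemma core_onE (T : OTrees) : core_on (cls T) = core_gen T.
Proof.
by apply: on_classesE => T' /clsP[f]; apply: core_gen_iso.
Qed.

Lemma ncore_onE (T : NTrees) : ncore_on (cls T) = core_gen (sval T).
Proof.
rewrite (core_gen_nt (svalP T)); apply: on_classesE => T' /clsP[f].
by rewrite -!core_gen_nt; apply: core_gen_iso.
Qed.

Lemma tensl1 (X Y : choiceType) : tensl Y (1 : Sym X) = 1.
Proof. exact: extend1. Qed.

Lemma tensr1 (X Y : choiceType) : tensr X (1 : Sym Y) = 1.
Proof. exact: extend1. Qed.

Section IncidenceCore.
Variables (T : otree) (hT : nontrivial T) (R : rtree).
Hypothesis i : riso (core hT) R.

Lemma free_incidence_core :
  extend2 core_on core_on (incidence_op (R := free_operad) T) = butcher_connes_kreimer_tree R.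
Proof.
have [th [th_bij th_adj th_root]] := i.
pose I : finType := {S : {set vtx R} | admissible S}.
have adm (x : @fibre free_operad T) : admissible (th @: fibre_cut x).
  by rewrite (admissible_root_closed th_bij th_adj th_root) cut_closed.
pose inv x : I := Sub (th @: fibre_cut x) (adm x).
pose g (S : {set vtx R}) : Sym2 RTrees RTrees :=
  (\prod_(B in components (~: S)) tensl RTrees (subtree_gen B)) *
    tensr RTrees (subtree_gen S).
transitivity (\sum_(S : I) g (val S)); last first.
  rewrite /butcher_connes_kreimer_tree (eq_bigl (mem (@admissible R))) //.
  by rewrite (big_sub (@admissible R) g).
rewrite /extend2; apply: (hsum_classified (inv := inv)).
- move=> x y; apply: (iff_trans (fibre_cut_hom x y)).
  split=> [E|/(congr1 val) /= /(imset_inj (bij_inj th_bij)) //].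
  by apply: val_inj; rewrite /= E.
- move=> S; pose S' := th @^-1: val S.
  have ES : th @: S' = val S.
    apply/setP => v; have [z ->] := th_surj th_bij v.
    by rewrite (mem_th th_bij) inE.
  have [|x xS] := @fibre_cut_surj T S'.
    by rewrite -(admissible_root_closed th_bij th_adj th_root) ES (valP S).
  by exists x; apply: val_inj; rewrite /= xS.
- by move=> x u v; apply: free_fibre_rigid.
move=> x; apply: etrans (extend2_term core_on core_on
  (fun l => cls (top (t := fpt x) l)) (cls (bot (fpt x)))) _.
rewrite /g /inv SubK.
rewrite (prod_components th_bij th_adj th_root (Defs.fpath x) (tensl1 _ _)).
rewrite (subtree_gen_cut th_bij th_adj th_root (Defs.fpath x)).
apply: (f_equal2 *%R); last exact: congr1 (core_onE (bot (fpt x))).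
by apply: eq_bigr => l _; exact: congr1 (core_onE (top l)).
Qed.

Let blob_term (P : {P : {set {set vtx R}} | tree_partition P}) : Sym2 RTrees RTrees :=
  (\prod_(B in val P) tensl RTrees (subtree_gen B)) *
    tensr RTrees (gen (rclass (contract (valP P)))).

(** The data that [hsum_classified] asks for, shared by the operad and by its
    action; the summand is in terms of [core_gen], to which both [core_on] and
    [ncore_on] reduce. *)
Lemma action_classifier : exists inv : @fibre bd_action T ->
    {P : {set {set vtx R}} | tree_partition P},
  [/\ forall x y, inhabited (fibre_hom x y) <-> inv x = inv y,
      forall P, exists x, inv x = P &
      forall x, blob_term (inv x) =
        (\prod_n tensl RTrees (core_gen (sval (top (t := fpt x) n)))) *
          tensr RTrees (core_gen (bot (fpt x)))].
Proof.
have [th [th_bij th_adj th_root]] := i.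
have thI := bij_inj th_bij.
pose im (P : {set {set node T}}) : {set {set vtx R}} :=
  (fun B : {set node T} => th @: B) @: P.
have imI : injective im by apply/imset_inj/imset_inj.
have part (x : @fibre bd_action T) : tree_partition (im (fibre_blobs x)).
  by rewrite (tree_partition_blob th_bij th_adj) blobs_partition.
exists (fun x => Sub (im (fibre_blobs x)) (part x)); split.
- move=> x y; apply: (iff_trans (fibre_blobs_hom x y)).
  split=> [E|/(congr1 val) /= /imI //].
  by apply: val_inj; rewrite /= E.
- move=> P; pose P' : {set {set node T}} := (fun B : {set vtx R} => th @^-1: B) @: val P.
  have EB (B : {set vtx R}) : th @: (th @^-1: B) = B.
    apply/setP => v; have [z ->] := th_surj th_bij v.
    by rewrite (mem_th th_bij) inE.
  have EP : im P' = val P.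
    rewrite /im /P' -imset_comp; apply/setP => B; apply/imsetP/idP => [[C CP ->]|BP].
      by rewrite /= EB.
    by exists B; rewrite //= EB.
  have [|x xP] := @fibre_blobs_surj T P'.
    by rewrite -(tree_partition_blob th_bij th_adj) -/(im P') EP (valP P).
  by exists x; apply: val_inj; rewrite /= xP.
move=> x; apply: (f_equal2 *%R).
  exact: (prod_blobs th_bij th_adj th_root (Defs.fpath x) (tensl RTrees)).
apply: congr1.
have hK : nontrivial (bot (fpt x)).
  have [g _ _] := fn_bij (Defs.fpath x); have /card_gt0P[n _] := hT.
  by apply/card_gt0P; exists (tag (g n)).
rewrite (core_gen_nt hK); apply: congr1; apply/rclassP/riso_sym.
have := contract_riso th_bij th_adj th_root (Defs.fpath x) hK.
congr (riso _ (contract _)).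
exact: bool_irrelevance.
Qed.

Lemma action_incidence_core :
  extend2 ncore_on core_on (incidence_op (R := bd_action) T) = extraction_contraction_tree R.
Proof.
have [inv [inv_hom inv_surj inv_term]] := action_classifier.
rewrite /extend2; apply: (hsum_classified inv_hom inv_surj (g := blob_term)).
  by move=> x u v; apply: bd_action_fibre_rigid.
move=> x; apply: etrans (extend2_term ncore_on core_on
  (fun n => cls (top (t := fpt x) n)) (cls (bot (fpt x)))) _.
rewrite inv_term; apply: (f_equal2 *%R); last exact: congr1 (core_onE (bot (fpt x))).
by apply: eq_bigr => n _; exact: congr1 (ncore_onE (top n)).
Qed.

End IncidenceCore.

Lemma operad_incidence_core (T : NTrees) (R : rtree) : riso (core (svalP T)) R ->
  extend2 ncore_on ncore_on (incidence_op (R := bd_operad) T) = extraction_contraction_tree R.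
Proof.
move=> i; have [inv [inv_hom inv_surj inv_term]] := action_classifier i.
rewrite /extend2; apply: (hsum_classified (inv := fun x => inv (to_action x))).
- by move=> x y; apply: iff_trans (inv_hom _ _); apply: to_action_hom.
- move=> P; have [y <-] := inv_surj P; have [x <-] := to_action_surj y.
  by exists x.
- by move=> x u v; apply: bd_operad_fibre_rigid.
move=> x; apply: etrans (extend2_term ncore_on ncore_on
  (fun n => cls (top (t := fpt x) n)) (cls (bot (fpt x)))) _.
apply: etrans (esym (inv_term (to_action x))).
apply: (f_equal2 *%R); last exact: congr1 (ncore_onE (bot (fpt x))).
by apply: eq_bigr => n _; exact: congr1 (ncore_onE (top n)).
Qed.

(** The trivial tree has a single decomposition, into trivial trees, whose cores
    are 1. *)
Section Trivial.
Variable T : otree.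
Hypothesis hT : ~~ nontrivial T.

Lemma trivial_node (n : node T) : False.
Proof. by case/negP: hT; apply/card_gt0P; exists n. Qed.

Lemma trivial_set (A B : {set node T}) : A = B.
Proof. by apply/setP => n; case: (trivial_node n). Qed.

Lemma core_gen_map_trivial (A : otree) : (node A -> node T) -> core_gen A = 1.
Proof.
move=> f; apply: core_gen_triv; apply/negP => /card_gt0P[n _].
exact: trivial_node (f n).
Qed.

Lemma free_incidence_trivial :
  extend2 core_on core_on (incidence_op (R := free_operad) T) = 1.
Proof.
transitivity (\sum_(j : unit) (1 : Sym2 RTrees RTrees)); last first.
  by rewrite big_const card_unit /= addr0.
rewrite /extend2; apply: (hsum_classified (inv := fun=> tt)).
- by move=> x y; apply: (iff_trans (fibre_cut_hom x y)); split=> // _; apply: trivial_set.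
- case; have [|x _] := @fibre_cut_surj T set0; last by exists x.
  by apply/root_closedP => n; case: (trivial_node n).
- by move=> x u v; apply: free_fibre_rigid.
move=> x; apply: etrans (extend2_term core_on core_on
  (fun l => cls (top (t := fpt x) l)) (cls (bot (fpt x)))) _.
rewrite -[RHS]mulr1; apply: (f_equal2 *%R).
  apply: big1 => l _; apply: etrans (tensl1 _ _); apply: congr1.
  apply: etrans (core_onE (top l)) _; apply: core_gen_map_trivial.
  exact: en (cut_top (Defs.fpath x) l).
apply: etrans (tensr1 _ _); apply: congr1.
apply: etrans (core_onE (bot (fpt x))) _; apply: core_gen_map_trivial.
exact: en (cut_bot (Defs.fpath x)).
Qed.

Lemma action_incidence_trivial :
  extend2 ncore_on core_on (incidence_op (R := bd_action) T) = 1.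
Proof.
transitivity (\sum_(j : unit) (1 : Sym2 RTrees RTrees)); last first.
  by rewrite big_const card_unit /= addr0.
have noblob (x : @fibre bd_action T) (n : node (bot (fpt x))) : False.
  have /card_gt0P[y _] := svalP (@top bd_action (fpt x) n).
  exact: trivial_node (fn (Defs.fpath x) (existT _ n y)).
rewrite /extend2; apply: (hsum_classified (inv := fun=> tt)).
- move=> x y; apply: (iff_trans (fibre_blobs_hom x y)); split=> // _.
  by apply/setP => B; apply/imsetP/imsetP => -[n]; case: (noblob _ n).
- case; have [|x _] := @fibre_blobs_surj T set0; last by exists x.
  apply/andP; split; last by apply/forall_inP => B; rewrite inE.
  by have -> : [set: node T] = set0; [apply: trivial_set | rewrite partition_set0].
- by move=> x u v; apply: bd_action_fibre_rigid.
move=> x; apply: etrans (extend2_term ncore_on core_on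
  (fun l => cls (top (t := fpt x) l)) (cls (bot (fpt x)))) _.
rewrite -[RHS]mulr1; apply: (f_equal2 *%R).
  by apply: big1 => n; case: (noblob _ n).
apply: etrans (tensr1 _ _); apply: congr1.
apply: etrans (core_onE (bot (fpt x))) _; apply: core_gen_map_trivial => n.
by case: (noblob _ n).
Qed.

End Trivial.

(** * Every rooted tree is a core *)

Section CoreExists.
Variable R : rtree.
Implicit Types x y : vtx R.

Let r := rroot R.

Lemma parent_ex x : x != r -> exists2 y, adj x y & (dist r y < dist r x)%N.
Proof.
have [p hp [Ep <-]] := dist_path r x; rewrite -{}Ep.
case/lastP: p hp => [|p z]; first by rewrite eqxx.
rewrite rcons_path last_rcons size_rcons => /andP[hp a] _.
by exists (last r p); [rewrite adj_sym | rewrite ltnS dist_le].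
Qed.

Definition parent x : vtx R :=
  odflt x [pick y | adj x y && (dist r y < dist r x)%N].

Lemma parentP x : x != r -> adj x (parent x) /\ (dist r (parent x) < dist r x)%N.
Proof.
move=> /parent_ex[y a lt]; rewrite /parent; case: pickP => [z /andP[]//|/(_ y)].
by rewrite a lt.
Qed.

(** Otherwise the walks from x and y to the root by way of parents would avoid the
   edge between x and y, which would thus lie on a circuit. *)
Lemma adj_parent x y : adj x y ->
  (x != r) && (parent x == y) || (y != r) && (parent y == x).
Proof.
move=> a; apply/negPn/negP; rewrite negb_or => /andP[nx ny].
have /negP := adj_acyc a; apply.
have C z : connect (cut_edge (@adj R) x y) z r.
  elim: {z}(dist r z).+1 {-2}z (ltnSn (dist r z)) => // n IH z lt.
  case: (eqVneq z r) => [-> //|zr]; have [az ltz] := parentP zr.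
  apply: connect_trans (IH (parent z) (leq_trans ltz lt)).
  apply: connect1; rewrite /cut_edge az /=; apply/negP => /eqP E.
  have : z \in [set x; y] by rewrite -E !inE eqxx.
  have : parent z \in [set x; y] by rewrite -E !inE eqxx orbT.
  have ne : parent z != z by apply: contraTneq az => ->; rewrite adj_irr.
  rewrite !inE => /orP[] /eqP Ep /orP[] /eqP Ez; rewrite ?Ep ?Ez ?eqxx // in ne zr.
    by case/negP: ny; rewrite -Ez Ep eqxx andbT Ez.
  by case/negP: nx; rewrite -Ez Ep eqxx andbT Ez.
apply: connect_trans (C x) _.
by rewrite (sym_connect_sym (cut_edge_sym _ _ (@adj_sym R))).
Qed.

(** A tree without leaves: each vertex is a node, whose output edge bears the same
    name. *)
Definition upward_diag : diagram :=
  @Diagram (vtx R) {x | x != r} (vtx R) val (fun m => parent (val m)) id.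

Lemma upward_srcP (e : edge upward_diag) :
  (e \in codom (@src upward_diag)) = (e != r).
Proof.
apply/codomP/idP => [[m ->]|h]; first exact: (valP m).
by exists (Sub (e : vtx R) h).
Qed.

Lemma upward_walkP (e : edge upward_diag) : exists k, iter k (@walk upward_diag) e = r.
Proof.
apply: walkI; first exact: val_inj.
move=> P P0 PS x.
elim: {x}(dist r x).+1 {-2}x (ltnSn (dist r x)) => // n IH x lt.
case: (eqVneq x r) => [-> //|xr].
apply: (PS (Sub (x : vtx R) xr)); apply: IH.
by have [_ ltx] := parentP xr; apply: leq_trans ltx lt.
Qed.

Definition upward : otree :=
  @OTree upward_diag r (@inj_id _) val_inj upward_srcP upward_walkP.

Lemma upward_child (x y : node upward) : child x y = (x != r) && (parent x == y).
Proof.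
apply/existsP/andP => [[m /andP[/eqP /= Em /eqP Ep]]|[h /eqP <-]].
  by rewrite -[x]Em -Ep (valP m).
by exists (Sub (x : vtx R) h); rewrite /= !eqxx.
Qed.

Lemma upward_nontrivial : nontrivial upward.
Proof. by apply/card_gt0P; exists r. Qed.

Lemma upward_core : riso (core upward_nontrivial) R.
Proof.
exists id; split; first by exists id.
  move=> x y; rewrite /= !upward_child; apply/idP/idP; first exact: adj_parent.
  case/orP=> /andP[/parentP[a _] /eqP E]; first by rewrite -E.
  by rewrite adj_sym -E.
exact: (tgt_rootnode upward_nontrivial).
Qed.

End CoreExists.

Lemma rclass_core (c : RTrees) : exists T : NTrees, gen c = core_gen (sval T).
Proof.
have [R <-] := class_of_surj c.
exists (exist _ (upward R) (upward_nontrivial R)).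
rewrite (core_gen_nt (upward_nontrivial R)); apply: congr1.
by apply/rclassP/riso_sym/upward_core.
Qed.

(** A choice of preimages of the generators extends to a section of the algebra
    map. *)
Lemma extend_onto (X Y : choiceType) (F : X -> Sym Y) :
  (forall y, exists x, F x = gen y) -> forall y, exists x, extend F x = y.
Proof.
move=> H y; pose s c := projT1 (cid (H c)).
have sE c : F (s c) = gen c by rewrite /s; case: cid.
exists (extend (fun c => gen (s c)) y).
apply: (Sym_ext (f := extend F \o extend (fun c => gen (s c))) (g := idfun)) => c /=.
by rewrite !extend_gen sE.
Qed.

(** The value of [on_classes] on the class of x is that of op on some object
    isomorphic to x, so op is to be evaluated at every object. *)
Lemma incidence_morphism (G : classified) (Y : choiceType) (A : comAlgType rat)
    (op : G -> Sym Y) (L : Y -> A) (C : pi0 G -> Sym RTrees) (D : RTrees -> A) :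
  (forall x : G, extend L (op x) = extend D (C (cls x))) ->
  forall x, extend L (extend (on_classes (@cls G) op) x) = extend D (extend C x).
Proof.
move=> H; apply: (Sym_ext (f := extend L \o extend (on_classes (@cls G) op))
  (g := extend D \o extend C)) => c.
have [x <-] := cls_surj c.
apply: etrans (congr1 (extend L) (extend_gen _ _)) _.
apply: etrans _ (esym (congr1 (extend D) (extend_gen _ _))).
by have [x' <- ->] := on_classesP (@cls G) op x; apply: H.
Qed.

Lemma on_rclass (A : comAlgType rat) (D : rtree -> A) (T : otree) (hT : nontrivial T) (v : A) :
  (forall R : rtree, riso (core hT) R -> v = D R) ->
  v = extend (on_classes rclass D) (core_gen T).
Proof.
move=> H; rewrite (core_gen_nt hT) extend_gen.
have [R E ->] := on_classesP rclass D (core hT).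
by apply: H; apply/rclassP/esym.
Qed.

Theorem proposition5p4p7 :
  [/\ (forall x : Sym (pi0 OTrees),
         extend2 core_on core_on (incidence (R := free_operad) x) =
         butcher_connes_kreimer (core_map x)),
      (forall x : Sym (pi0 NTrees),
         extend2 ncore_on ncore_on (incidence (R := bd_operad) x) =
         extraction_contraction (ncore_map x)),
      (forall x : Sym (pi0 OTrees),
         extend2 ncore_on core_on (incidence (R := bd_action) x) =
         extraction_contraction_coaction (core_map x)),
      (forall y : Sym RTrees, exists x : Sym (pi0 OTrees), core_map x = y) &
      (forall y : Sym RTrees, exists x : Sym (pi0 NTrees), ncore_map x = y)].
Proof.
split.
- apply: (incidence_morphism (G := OTrees)) => T; rewrite (core_onE T).
  case: (boolP (nontrivial T)) => hT.
    exact: (on_rclass (fun R => @free_incidence_core T hT R)).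
  apply: etrans (free_incidence_trivial hT) _.
  by rewrite (core_gen_triv hT) extend1.
- apply: (incidence_morphism (G := NTrees)) => T; rewrite (ncore_onE T).
  exact: (on_rclass (fun R => @operad_incidence_core T R)).
- apply: (incidence_morphism (G := OTrees)) => T; rewrite (core_onE T).
  case: (boolP (nontrivial T)) => hT.
    exact: (on_rclass (fun R => @action_incidence_core T hT R)).
  apply: etrans (action_incidence_trivial hT) _.
  by rewrite (core_gen_triv hT) extend1.
- apply: extend_onto => c; have [T E] := rclass_core c.
  exists (cls (sval T : OTrees)); exact: etrans (core_onE (sval T)) (esym E).
apply: extend_onto => c; have [T E] := rclass_core c.
by exists (cls T); exact: etrans (ncore_onE T) (esym E).
Qed.
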